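(* Let $B(t)$, $t\in\mathbb{R}$, be a centered separable Gaussian process with stationary increments, sample paths bounded on compact intervals, and variance function $\sigma^2(t)=\mathrm{Var}(B(t))$. Let $f:[0,\infty)\to\mathbb{R}$ be a locally bounded measurable function such that, for some constant $a>1$, $f(t)>a\ln t$ for all $t>0$. Then $\mathcal{P}_f([0,\infty))<\infty$, and moreover $$\mathcal{P}_f([0,\infty))\le\inf_{\delta>0}\ \mathcal{W}(\delta)\sum_{i=0}^\infty\ \sup_{t\in[i,i+1]}e^{-f(t\delta)}<\infty.$$
   Context: The Piterbarg constant is $$\mathcal{P}_f([0,\infty))=\mathbb{E}\Big\{\sup_{t\in[0,\infty)}e^{B(t)-\sigma^2(t)/2-f(t)}\Big\},$$ and the Wills functional is $$\mathcal{W}(s)=\mathbb{E}\Big\{\sup_{t\in[0,s]}e^{B(t)-\sigma^2(t)/2}\Big\},\quad s>0.$$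
   Formalization: Separability is assumed of the pair (B(t), σ²(t)), which is ordinary separability of B when σ² is continuous; for discontinuous σ², separability of B alone is not enough and the stated inequality can fail. *)

(* Defs.v *)
From HB Require Import structures.
From mathcomp Require Import all_boot all_order all_algebra.
From mathcomp Require Import all_classical all_reals all_analysis.
Import Order.TTheory GRing.Theory Num.Theory numFieldNormedType.Exports.

Set Implicit Arguments.
Unset Strict Implicit.
Unset Printing Implicit Defensive.

Local Open Scope classical_set_scope.
Local Open Scope ring_scope.

Section processes.
Context (d : measure_display) (T : measurableType d) (R : realType).
Variable P : probability T R.

(* The degenerate case is kept apart because normal_prob m 0 is, by the
   library's convention, the uniform law on [0, 1] and not the Dirac mass. *)
Definition gaussian (X : T -> R) : Prop :=
  (exists m : R, forall A, measurable A -> P (X @^-1` A) = \d_m A) \/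
  (exists m s : R, 0 < s /\
     forall A, measurable A -> P (X @^-1` A) = normal_prob m s A).

Definition gaussian_process (B : R -> {RV P >-> R}) : Prop :=
  forall (n : nat) (t c : 'I_n -> R),
    gaussian (fun w => \sum_(i < n) c i * B (t i) w).

Definition centered (B : R -> {RV P >-> R}) : Prop :=
  forall t, ('E_P[B t] = 0)%E.

(* The finite-dimensional laws of (B (t + h) - B h)_t do not depend on h;
   no normalization B 0 = 0 is imposed. *)
Definition stationary_increments (B : R -> {RV P >-> R}) : Prop :=
  forall (h : R) (n : nat) (t : 'I_n -> R) (A : 'I_n -> set R),
    (forall i, measurable (A i)) ->
    P [set w | forall i, A i (B (t i + h) w - B h w)] =
    P [set w | forall i, A i (B (t i) w - B 0 w)].

Definition bounded_paths (B : R -> {RV P >-> R}) : Prop :=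
  {ae P, forall w, forall a b : R, [bounded B t w | t in `[a, b]]}.

(* 'V_P is extended-real valued; it is finite for Gaussian variables. *)
Definition variance_function (B : R -> {RV P >-> R}) (t : R) : R :=
  fine ('V_P[B t])%E.

(* Separability in the sense of Doob, for a process with values in E: outside
   a negligible set, the graph of the path is contained in the closure of the
   graph of its restriction to a countable set D (which is then dense). *)
Definition separable (E : topologicalType) (X : R -> T -> E) : Prop :=
  exists2 D : set R, countable D &
    {ae P, forall w, forall t e : R, 0 < e ->
       closure [set X s w | s in D `&` ball t e] (X t w)}.

(* Separability of t |-> (B t, variance of B t).  It implies separability of
   B - sigma^2 / 2, whose supremum over an interval is then almost surely a
   supremum over a countable set, and it is the same as separability of B when
   sigma^2 is continuous.  When sigma^2 is discontinuous, separability of B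
   alone does not let the law of B determine the law of such a supremum. *)
Definition separable_with_variance (B : R -> {RV P >-> R}) : Prop :=
  separable (fun t w => (B t w, variance_function B t)).

Local Open Scope ereal_scope.

(* The integral of a nonnegative function that is only almost everywhere equal
   to a measurable one is the integral of the latter. *)
Definition piterbarg (B : R -> {RV P >-> R}) (f : R -> R) : \bar R :=
  \int[P]_w ereal_sup
    [set (expR (B t w - variance_function B t / 2 - f t))%:E | t in `[0%R, +oo[].

Definition wills (B : R -> {RV P >-> R}) (s : R) : \bar R :=
  \int[P]_w ereal_sup
    [set (expR (B t w - variance_function B t / 2))%:E | t in `[0%R, s]].

End processes.

Definition locally_bounded (R : realType) (f : R -> R) : Prop :=
  forall t : R, 0 <= t -> bounded_near f (within `[0, +oo[ (nbhs t)).

Definition piterbarg_bound (d : measure_display) (T : measurableType d)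
    (R : realType) (P : probability T R) (B : R -> {RV P >-> R}) (f : R -> R)
    (delta : R) : \bar R :=
  (wills B delta * \sum_(0 <= i <oo)
    ereal_sup [set (expR (- f (t * delta)))%:E | t in `[i%:R, i.+1%:R]])%E.

(* Main.v *)
(* Write Y t = B t - sigma^2(t) / 2.  On [i delta, (i + 1) delta] the integrand
   of the Piterbarg constant is at most sup exp Y times sup exp (- f), so the
   inequality amounts to the fact that the expectation of sup exp Y over
   [h, h + delta] does not depend on h.  Separability and monotone convergence
   reduce it to finitely many times.  There exp (Y h) is a Gaussian change of
   measure (Cameron-Martin) under which B (t + h) - B h acquires as drift its
   covariance with B h, and
     sigma^2(t + h) = Var (B (t + h) - B h) + 2 Cov (B (t + h) - B h, B h)
                      + sigma^2(h),
   so E max exp (Y (t_i + h)) only involves the increments B (t_i + h) - B h,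
   whose joint law is stationary.  Laws weighted by a density are identified
   by their cosine transforms, smoothed by narrow normal kernels.
   The Wills functional is finite by Fernique's argument: rotating two
   independent copies of B by 45 degrees yields a tail bound for max |B (t_i)|
   that does not depend on the number of times. *)

Require Import Defs.
From HB Require Import structures.
From mathcomp Require Import all_boot all_order all_algebra.
From mathcomp Require Import all_classical all_reals all_analysis.
From mathcomp Require Import measurable_realfun ring lra.
Import Order.TTheory GRing.Theory Num.Theory numFieldNormedType.Exports.

Set Implicit Arguments.
Unset Strict Implicit.
Unset Printing Implicit Defensive.

Local Open Scope classical_set_scope.
Local Open Scope ring_scope.

(** * Integration *)

(** The suprema over intervals need not be measurable. The integral of a nonnegative function is a
    lower integral: monotone in general, but additive only for measurable functions. So no series or
    limit is ever exchanged with an integral of an interval supremum. The exchanges are made for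
    [sampled_sup], a supremum along one sequence of times, whose expectation [q] is tied to the
    Wills functional by two comparisons. Inclusion of times gives [q <= wills B delta], which enters
    the main inequality; almost sure domination gives the converse, which makes the Wills functional
    finite. The same sequence must serve every interval, for otherwise shift invariance would
    compare maxima over different sets of times. Cosines with a free phase carry the information of
    a characteristic function while everything stays real. A cosine of some coordinates can be
    absorbed into an integrable signed weight, so the uniqueness theorem for vectors follows from
    the one for variables by induction, without multivariate densities and without separating
    degenerate covariances. Boxes suffice as test sets: stationarity is stated on boxes, and a
    maximum lies below a level exactly on a box. *)

Section integration.
Context d (T : measurableType d) (R : realType).
Local Open Scope ereal_scope.

(** The integral of a nonnegative function is a supremum over the simple functions below it, and
    enlarging the function enlarges that family. This is how suprema over uncountable sets of times
    are compared. *)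
Lemma ge0_le_lower_integral (mu : {measure set T -> \bar R})
    (f g : T -> \bar R) : (forall x, 0 <= f x) -> (forall x, f x <= g x) ->
  \int[mu]_x f x <= \int[mu]_x g x.
Proof.
move=> f0 fg; rewrite !ge0_integralTE//; last by move=> x; exact: le_trans (fg x).
apply: le_ereal_sup => _ [h hf <-]; exists h => //.
by move=> x; apply: le_trans (fg x).
Qed.

Lemma ae_ge0_le_lower_integral (mu : {measure set T -> \bar R})
    (f g : T -> \bar R) :
  (forall x, 0 <= f x) -> (forall x, 0 <= g x) -> measurable_fun [set: T] g ->
  {ae mu, forall x, f x <= g x} -> \int[mu]_x f x <= \int[mu]_x g x.
Proof.
move=> f0 g0 mg [N [mN N0 sN]].
(* Raising [g] to infinity on the exceptional set makes the inequality hold everywhere and leaves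
   the integral of the measurable side unchanged. *)
pose g' x := if x \in N then +oo else g x.
have mg' : measurable_fun [set: T] g'.
  apply: measurable_fun_ifT => //.
  by apply: (measurable_fun_bool true) => /=; rewrite setTI preimage_mem_true.
have g'0 x : 0 <= g' x by rewrite /g'; case: ifP => // _; rewrite leey.
have fg' x : f x <= g' x.
  rewrite /g'; case: ifPn => [_|/negP xN]; first by rewrite leey.
  by apply: contrapT => h; apply: xN; rewrite inE; exact: sN.
rewrite (@ge0_ae_eq_integral _ _ _ mu setT g g')//; last first.
  exists N; split=> // x /=; apply: contra_notP => xN _.
  by rewrite /g' memNset.
exact: ge0_le_lower_integral.
Qed.

(** [p] and the Radon-Nikodym derivative of [nu] have the same integral over every measurable set,
    hence agree almost everywhere, and the change of variables known for the latter transfers to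
    [p]. *)
Lemma ge0_integral_density (nu : {finite_measure set T -> \bar R})
    (mu : {sigma_finite_measure set T -> \bar R}) (p f : T -> \bar R) :
  mu.-integrable setT p ->
  (forall A, measurable A -> nu A = \int[mu]_(x in A) p x) ->
  measurable_fun [set: T] f -> (forall x, 0 <= f x) ->
  \int[nu]_x f x = \int[mu]_x (f x * p x).
Proof.
move=> ip nup mf f0.
have numu : nu `<< mu.
  apply/null_content_dominatesP => A mA A0; rewrite nup//.
  apply: null_set_integral => //.
  by apply: measurable_funTS; exact: (measurable_int mu).
rewrite -(Radon_Nikodym_SigmaFinite.change_of_variables numu)//.
have iq := Radon_Nikodym_SigmaFinite.f_integrable numu.
apply: ae_eq_integral => //.
- by apply: emeasurable_funM => //; exact: (measurable_int mu).
- by apply: emeasurable_funM => //; exact: (measurable_int mu).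
apply: ae_eqe_mul2l.
apply: (integral_ae_eq measurableT iq); first exact: (measurable_int mu).
move=> E _ mE; rewrite -nup//.
by rewrite -(Radon_Nikodym_SigmaFinite.f_integral numu).
Qed.

End integration.

Section Rintegral_fubini.
Context d1 d2 (T1 : measurableType d1) (T2 : measurableType d2) (R : realType).
Variables (m1 : {sigma_finite_measure set T1 -> \bar R})
  (m2 : {sigma_finite_measure set T2 -> \bar R}).
Variables (f : T1 * T2 -> R) (g : T1 -> R) (h : T2 -> R).
Hypothesis mf : measurable_fun [set: T1 * T2] f.
Hypothesis ig : m1.-integrable setT (EFin \o g).
Hypothesis ih : m2.-integrable setT (EFin \o h).
Hypothesis fgh : forall x y, `|f (x, y)| <= g x * h y.

(** Domination by a product of integrable functions fits every later use of Fubini: a weight times a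
    cosine, a weight times a truncated density, a cosine on a product of probability spaces. *)
Lemma integrable_prod_dominated : (m1 \x m2)%E.-integrable setT (EFin \o f).
Proof.
have mh := measurable_int _ ih; have mg := measurable_int _ ig.
have mg' : measurable_fun setT g by apply/measurable_EFinP.
have mh' : measurable_fun setT h by apply/measurable_EFinP.
apply/(integrable12ltyP m1 m2); first exact/measurable_EFinP.
apply: (@le_lt_trans _ _ (\int[m1]_x (`|(g x)%:E| * \int[m2]_y `|(h y)%:E|))%E).
  apply: ge0_le_integral => //.
  - by move=> x _; exact: integral_ge0.
  - apply: (@measurable_fun_fubini_tonelli_F _ _ T1 T2 R m2 (fun z => `|(f z)%:E|%E)) => //.
    by apply: measurableT_comp => //; exact/measurable_EFinP.
  - apply: emeasurable_funM => //; exact: measurableT_comp.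
  move=> x _; rewrite -ge0_integralZl//; last exact: measurableT_comp.
  apply: ge0_le_integral => //.
  - apply: measurableT_comp => //; apply/measurable_EFinP.
    exact: (measurableT_comp mf).
  - by apply: emeasurable_funM => //; exact: measurableT_comp.
  - move=> y _; rewrite /= lee_fin (le_trans (fgh x y))// -normrM.
    exact: ler_norm.
rewrite ge0_integralZr//.
- apply: lte_mul_pinfty.
  + exact: integral_ge0.
  + exact/integrable_fin_num/integrable_abse.
  + by have /integrableP[] := ih.
- exact: measurableT_comp.
- exact: integral_ge0.
Qed.

Lemma Rintegral_prod : \int[(m1 \x m2)%E]_z f z = \int[m1]_x \int[m2]_y f (x, y).
Proof.
have i12 := integrable_prod_dominated.
rewrite /Rintegral -(integral12_prod_meas1 i12); congr fine.
apply: eq_integral => x _; rewrite /fubini_F/= fineK//.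
apply: integrable_fin_num => //; apply: (@le_integrable _ _ _ _ _ _ _ (fun y => (g x)%:E * (EFin \o h) y)%E) => //.
- by apply/measurable_EFinP; exact: measurableT_comp.
- by move=> y _ /=; rewrite lee_fin (le_trans (fgh x y)) ?ler_norm.
- exact: integrableZl.
Qed.

Lemma Rintegral_fubini :
  \int[m1]_x \int[m2]_y f (x, y) = \int[m2]_y \int[m1]_x f (x, y).
Proof.
have i12 := integrable_prod_dominated.
rewrite -Rintegral_prod /Rintegral -(integral21_prod_meas1 i12); congr fine.
apply: eq_integral => y _; rewrite /fubini_G/= fineK//.
apply: integrable_fin_num => //; apply: (@le_integrable _ _ _ _ _ _ _ (fun x => (h y)%:E * (EFin \o g) x)%E) => //.
- by apply/measurable_EFinP; exact: measurableT_comp.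
- by move=> x _ /=; rewrite lee_fin (le_trans (fgh x y)) 1?mulrC ?ler_norm.
- exact: integrableZl.
Qed.

End Rintegral_fubini.

Section integrable_dominated.
Context d (T : measurableType d) (R : realType).
Variable mu : {measure set T -> \bar R}.

Lemma integrable_dominated (f g : T -> R) :
  measurable_fun [set: T] f -> (forall x, `|f x| <= g x) ->
  mu.-integrable setT (EFin \o g) -> mu.-integrable setT (EFin \o f).
Proof.
move=> mf fg ig; apply: le_integrable ig => //; first exact/measurable_EFinP.
by move=> x _ /=; rewrite lee_fin (le_trans (fg x)) ?ler_norm.
Qed.

Lemma integrable_scale (c : R) (f : T -> R) :
  mu.-integrable setT (EFin \o f) ->
  mu.-integrable setT (EFin \o (fun x => c * f x)).
Proof. by move=> /(integrableZl measurableT c). Qed.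

Lemma integrable_add (f g : T -> R) :
  mu.-integrable setT (EFin \o f) -> mu.-integrable setT (EFin \o g) ->
  mu.-integrable setT (EFin \o (fun x => f x + g x)).
Proof. by move=> if_ ig; have := integrableD measurableT if_ ig. Qed.

End integrable_dominated.

Lemma Rintegral_probability_cst d (T : measurableType d) (R : realType)
  (P : probability T R) (r : R) : \int[P]__ r = r.
Proof.
by rewrite Rintegral_cst// [fine _](congr1 fine (probability_setT P)) mulr1.
Qed.

Lemma measurable_cos (R : realType) : measurable_fun [set: R] (@cos R).
Proof. exact: (continuous_measurable_fun (@continuous_cos R)). Qed.

Lemma measurable_sin (R : realType) : measurable_fun [set: R] (@sin R).
Proof. exact: (continuous_measurable_fun (@continuous_sin R)). Qed.

Section integral_of_derivative.
Context (R : realType).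
Notation mu := (@lebesgue_measure R).

(** The fundamental theorem of calculus on [[- n.+1, n.+1]], then dominated convergence. Exhausting
    the line by these intervals only calls for the limits of [g] along integers. *)
Lemma integral_derive0 (g g' : R -> R) :
  (forall x : R, is_derive x (1 : R) g (g' x)) -> continuous g' ->
  mu.-integrable setT (EFin \o g') ->
  g n%:R @[n --> \oo] --> 0 -> g (- n%:R) @[n --> \oo] --> 0 ->
  \int[mu]_x g' x = 0.
Proof.
move=> dg cg' ig' gy gNy.
pose I n := [set` `[- n.+1%:R : R, n.+1%:R]].
have FTC n : (\int[mu]_x ((EFin \o g') \_ (I n)) x =
    (g n.+1%:R - g (- n.+1%:R))%:E)%E.
  rewrite -integral_mkcond (@continuous_FTC2 _ g' g)//.
  - by rewrite (@lt_trans _ _ 0)// oppr_lt0.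
  - exact: continuous_subspaceT.
  - have cg x : {for x, continuous g}.
      by apply/differentiable_continuous/derivable1_diffP; case: (dg x).
    split.
    + by move=> x _; case: (dg x).
    + by apply: cvg_at_right_filter; exact: cg.
    + by apply: cvg_at_left_filter; exact: cg.
  - by move=> x _; rewrite derive1E; case: (dg x).
have lim1 : ((g n.+1%:R - g (- n.+1%:R))%:E @[n --> \oo] --> 0%:E)%E.
  apply: cvg_EFin; first exact: nearW.
  rewrite -[X in _ --> X](subr0 0); apply: cvgB.
    by have := gy; rewrite -cvg_shiftS.
  by have := gNy; rewrite -(cvg_shiftS (fun n => g (- n%:R))).
have lim2 : (\int[mu]_x ((EFin \o g') \_ (I n)) x @[n --> \oo] -->
    \int[mu]_x (g' x)%:E)%E.
  have mg' := measurable_int _ ig'.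
  apply: (@dominated_cvg _ _ _ mu _ _ _ _ (fun x => `|(g' x)%:E|)%E) => //.
  - move=> n; apply/(measurable_restrictT _ _).1; first exact: measurable_itv.
    exact: measurable_funTS.
  - move=> x _; apply: cvg_near_cst; near=> n => /=.
    rewrite patchE mem_set// /I /= in_itv/= -ler_norml.
    apply: (@le_trans _ _ n%:R); last by rewrite ler_nat.
    by near: n; exact: nbhs_infty_ger.
  - exact: integrable_abse.
  - move=> n x _; rewrite patchE; case: ifP => // _.
    by rewrite abse0.
rewrite /Rintegral.
move: lim2; rewrite (funext FTC) => lim2.
by rewrite (cvg_unique _ lim2 lim1).
Unshelve. all: by end_near. Qed.

End integral_of_derivative.

(** * The normal law *)

Section normal_law.
Context (R : realType) (m s : R).
Hypothesis s_gt0 : 0 < s.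
Notation mu := (@lebesgue_measure R).
Notation p := (normal_pdf m s).
Notation nu := (normal_prob m s).

Lemma ge0_integral_normal_prob (f : R -> \bar R) :
  measurable_fun [set: R] f -> (forall x, 0 <= f x)%E ->
  (\int[nu]_x f x = \int[mu]_x (f x * (p x)%:E))%E.
Proof.
by move=> mf f0; apply: ge0_integral_density => //; exact: integrable_normal_pdf.
Qed.

Let p_ge0 x : 0 <= p x. Proof. exact: normal_pdf_ge0. Qed.
Let mp : measurable_fun [set: R] p. Proof. exact: measurable_normal_pdf. Qed.

Lemma integrable_normal_prob (f : R -> R) : measurable_fun [set: R] f ->
  nu.-integrable setT (EFin \o f) <->
  mu.-integrable setT (EFin \o (fun x => f x * p x)).
Proof.
move=> mf.
have E : (\int[nu]_x `|(f x)%:E| = \int[mu]_x `|(f x * p x)%:E|)%E.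
  rewrite ge0_integral_normal_prob//; last first.
    by apply: measurableT_comp => //; exact/measurable_EFinP.
  by apply: eq_integral => x _; rewrite EFinM abseM (@gee0_abs _ (p x)%:E)// lee_fin.
split=> /integrableP[_ h]; apply/integrableP; split.
- by apply/measurable_EFinP/measurable_funM.
- by rewrite -E.
- exact/measurable_EFinP.
- by rewrite E.
Qed.

Lemma Rintegral_normal_prob (f : R -> R) : measurable_fun [set: R] f ->
  \int[nu]_x f x = \int[mu]_x (f x * p x).
Proof.
move=> mf; rewrite /Rintegral; congr fine.
have mEf : measurable_fun [set: R] (EFin \o f) by exact/measurable_EFinP.
rewrite integralE [RHS]integralE !ge0_integral_normal_prob//.
- congr (_ - _)%E; apply: eq_integral => x _.
  + by rewrite !funeposE EFinM maxe_pMl ?mul0e ?lee_fin.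
  + by rewrite !funenegE maxe_pMl ?mul0e ?lee_fin// mulNe -EFinM.
- exact: measurable_funeneg.
- exact: measurable_funepos.
Qed.

Let pE x : p x = normal_peak s * expR (- ((x - m) ^+ 2 / (s ^+ 2 *+ 2))).
Proof. by rewrite normal_pdfE ?gt_eqF// /normal_fun mulNr. Qed.

(** This is [y <= expR y] at [y = (x - m) ^+ 2 / (s ^+ 2 *+ 2)]. *)
Lemma sqr_normal_pdf_le x :
  (x - m) ^+ 2 * p x <= s ^+ 2 *+ 2 * normal_peak s.
Proof.
have s2 : 0 < s ^+ 2 *+ 2 by rewrite pmulrn_lgt0// exprn_gt0.
rewrite pE mulrCA [leRHS]mulrC ler_wpM2l ?normal_peak_ge0// expRN.
rewrite ler_pdivrMr ?expR_gt0// -ler_pdivrMl// mulrC.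
by apply: le_trans (expR_ge1Dx _); rewrite lerDr.
Qed.

Lemma integrable_normal_prob_sqr :
  nu.-integrable setT (EFin \o (fun x => (x - m) ^+ 2)).
Proof.
have mY : measurable_fun [set: R] (fun x : R => (x - m) ^+ 2).
  by apply: measurable_funX; exact: measurable_funB.
apply/(integrable_normal_prob mY).2.
(* The comparison is with the normal density of doubled standard deviation: the exponents differ by
   [3 / (8 * s ^+ 2)] times the square, and [y <= expR y] at that value absorbs the factor
   [(x - m) ^+ 2]. *)
pose C := (s ^+ 2 *+ 8 / 3) * normal_peak s / normal_peak (2 * s).
have s20 : 2 * s != 0 by rewrite mulf_neq0 ?gt_eqF.
apply: (@integrable_dominated _ _ _ mu _ (fun x => C * normal_pdf m (2 * s) x)).
- exact: measurable_funM.
- move=> x; rewrite !ger0_norm; last by rewrite mulr_ge0 ?sqr_ge0.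
  rewrite pE normal_pdfE// /normal_fun /C.
  set y := (x - m) ^+ 2.
  have -> : s ^+ 2 *+ 8 / 3 * normal_peak s / normal_peak (2 * s) *
      (normal_peak (2 * s) * expR (- y / ((2 * s) ^+ 2 *+ 2))) =
      normal_peak s * (s ^+ 2 *+ 8 / 3 * expR (- y / ((2 * s) ^+ 2 *+ 2))).
    by field; rewrite gt_eqF// normal_peak_gt0.
  rewrite mulrCA ler_wpM2l ?normal_peak_ge0// expRN ler_pdivrMr ?expR_gt0//.
  rewrite -[leRHS]mulrA -expRD.
  have -> : - y / ((2 * s) ^+ 2 *+ 2) + y / (s ^+ 2 *+ 2) = y / (s ^+ 2 *+ 8 / 3).
    by field; rewrite gt_eqF.
  have s8 : 0 < s ^+ 2 *+ 8 / 3 by rewrite divr_gt0// pmulrn_lgt0// exprn_gt0.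
  rewrite -ler_pdivrMl// mulrC.
  by apply: le_trans (expR_ge1Dx _); rewrite lerDr.
- by apply: integrable_scale; exact: integrable_normal_pdf.
Qed.

Lemma is_derive_normal_pdf (x : R) :
  is_derive x (1 : R) p (- ((x - m) / s ^+ 2) * p x).
Proof.
pose c : R := - (s ^+ 2 *+ 2)^-1.
have -> : p = (normal_peak s *: (expR \o (c *: (@id R - cst m) ^+ 2)))%R.
  apply/funext => y; rewrite pE /c /= !fctE/= /GRing.scale/= -mulNr.
  by congr (_ * expR _); field; rewrite gt_eqF.
apply: is_derive_eq; rewrite /GRing.scale/= !fctE/= /GRing.scale /= /c.
by field; rewrite gt_eqF.
Qed.

(** Quadratic decay is what Stein's identity calls for: one power pays for the linear growth of the
    test function, the other makes the boundary terms vanish. *)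
Lemma normal_pdf_tail (x : R) :
  (1 + `|x - m|) ^+ 2 * p x <= (2 + s ^+ 2 *+ 4) * normal_peak s.
Proof.
have y2 : (1 + `|x - m|) ^+ 2 <= 2 + 2 * (x - m) ^+ 2.
  rewrite -[X in _ + 2 * X]real_normK ?num_real//; have := sqr_ge0 (1 - `|x - m|).
  rewrite !expr2; lra.
apply: (le_trans (ler_wpM2r (p_ge0 x) y2)).
have := sqr_normal_pdf_le x.
have : p x <= normal_peak s by apply: normal_pdf_ub; rewrite gt_eqF.
by rewrite !mulr2n; lra.
Qed.

Lemma integrable_normal_prob_le (A : R) (f : R -> R) : measurable_fun setT f ->
  (forall x, `|f x| <= A * (1 + (x - m) ^+ 2)) ->
  nu.-integrable setT (EFin \o f).
Proof.
move=> mf fA; apply: (@integrable_dominated _ _ _ nu _ _ mf fA).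
apply: integrable_scale; apply: integrable_add.
- exact: finite_measure_integrable_cst.
- exact: integrable_normal_prob_sqr.
Qed.

(** Stein's identity, that is, integration by parts based on [p' = - ((x - m) / s ^+ 2) * p]. It
    yields the mean, the variance and the differential equation of the cosine transform. *)
Lemma normal_prob_stein (h h' : R -> R) (A : R) :
  (forall x : R, is_derive x (1 : R) h (h' x)) -> continuous h' ->
  (forall x, `|h x| <= A * (1 + `|x - m|)) -> (forall x, `|h' x| <= A) ->
  \int[nu]_x ((x - m) * h x) = s ^+ 2 * \int[nu]_x h' x.
Proof.
move=> dh ch' hA h'A.
have A0 : 0 <= A := le_trans (normr_ge0 _) (h'A 0).
have ch : continuous h.
  by move=> x; apply/differentiable_continuous/derivable1_diffP; case: (dh x).
have mh : measurable_fun [set: R] h by exact: continuous_measurable_fun.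
have mh' : measurable_fun [set: R] h' by exact: continuous_measurable_fun.
have ih' : nu.-integrable setT (EFin \o h').
  apply: (@integrable_normal_prob_le A) => // x.
  by rewrite (le_trans (h'A x))// ler_peMr// lerDl sqr_ge0.
have myh : measurable_fun [set: R] (fun x : R => (x - m) * h x).
  by apply: measurable_funM => //; exact: measurable_funB.
have iyh : nu.-integrable setT (EFin \o (fun x => (x - m) * h x)).
  apply: (@integrable_normal_prob_le (A *+ 2)) => // x; rewrite normrM.
  rewrite (le_trans (ler_wpM2l (normr_ge0 _) (hA x)))// mulrCA.
  rewrite mulrnAl -mulrnAr ler_wpM2l// -[X in _ <= (1 + X) *+ _]real_normK ?num_real//.
  have := sqr_ge0 (1 - `|x - m|); have := normr_ge0 (x - m).
  by rewrite !expr2 mulr2n; lra.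
(* Chosen so that [k * p] is the derivative of [h * p]; the claim is that its integral is zero. *)
pose k x := h' x - (s ^+ 2)^-1 * ((x - m) * h x).
have mk : measurable_fun [set: R] k.
  by apply: measurable_funB => //; exact: measurable_funM.
have ik : nu.-integrable setT (EFin \o k).
  have := integrableB measurableT ih' (integrable_scale (s ^+ 2)^-1 iyh).
  exact.
(* One statement covers both ends [n] and [- n]. Since [n.+1] is at most
   [(1 + |u n - m|) * (1 + |m|)], the quadratic decay of the density turns into a bound
   [C / n.+1]. *)
have tail (u : nat -> R) : (forall n, `|u n| = n%:R) ->
    (fun n => h (u n) * p (u n)) @ \oo --> (0 : R).
  move=> un; apply: norm_cvg0.
  pose C := A * ((2 + s ^+ 2 *+ 4) * normal_peak s) * (1 + `|m|).
  apply: (@squeeze_cvgr _ _ _ _ (cst 0) (fun n => C * harmonic n)) => //.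
  - apply: nearW => n; rewrite normr_ge0/= normrM (ger0_norm (p_ge0 _)).
    rewrite ler_pdivlMr ?ltr0n//.
    apply: (@le_trans _ _ (A * ((1 + `|u n - m|) ^+ 2 * p (u n)) * (1 + `|m|))).
      rewrite (le_trans (ler_wpM2r _ (ler_wpM2r (p_ge0 _) (hA _))))//.
      have : n.+1%:R <= (1 + `|u n - m|) * (1 + `|m|).
        have := ler_distD 0 (u n) m.
        have : `|u n| <= `|u n - m| + `|m| by rewrite -{1}(subrK m (u n)) ler_normD.
        have := mulr_ge0 (normr_ge0 (u n - m)) (normr_ge0 m).
        by rewrite un -natr1; lra.
      have q0 : 0 <= A * (1 + `|u n - m|) * p (u n).
        by rewrite !mulr_ge0// addr_ge0.
      move=> /(ler_wpM2l q0); rewrite -!mulrA => /le_trans; apply.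
      by rewrite le_eqVlt; apply/orP; left; apply/eqP; ring.
    by rewrite /C ler_wpM2r ?addr_ge0// ler_wpM2l// normal_pdf_tail.
  - exact: cvg_cst.
  - by rewrite -[X in _ --> X](mulr0 C); apply: cvgM;
      [exact: cvg_cst|exact: cvg_harmonic].
have : \int[nu]_x k x = 0.
  rewrite Rintegral_normal_prob//.
  apply: (@integral_derive0 _ (fun x => h x * p x)).
  - move=> x; have dp := is_derive_normal_pdf x; have dhx := dh x.
    rewrite (_ : (fun _ => _) = h * p)//.
    apply: is_derive_eq; rewrite /GRing.scale/= /k.
    by field; rewrite gt_eqF.
  - move=> x; apply: cvgM; last by apply: continuous_normal_pdf; rewrite gt_eqF.
    apply: cvgB; first exact: ch'.
    apply: cvgM; first exact: cvg_cst.
    apply: cvgM; last exact: ch.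
    by apply: cvgB; [exact: cvg_id|exact: cvg_cst].
  - exact/(integrable_normal_prob mk).1.
  - by apply: tail => n; rewrite normr_nat.
  - by apply: tail => n; rewrite normrN normr_nat.
rewrite RintegralB//; last exact: integrable_scale.
rewrite RintegralZl// => /eqP; rewrite subr_eq0 => /eqP ->.
by rewrite mulrA divff ?mul1r// gt_eqF// exprn_gt0.
Qed.

Lemma normal_prob_mean : \int[nu]_x x = m.
Proof.
have mB : measurable_fun [set: R] (fun x : R => x - m) by exact: measurable_funB.
have iB : nu.-integrable setT (EFin \o (fun x => x - m)).
  apply: (@integrable_normal_prob_le 1) => // x; rewrite mul1r.
  rewrite -[X in 1 + X]real_normK ?num_real//.
  by have := sqr_ge0 (1 - `|x - m|); have := normr_ge0 (x - m); rewrite !expr2; lra.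
have E0 : \int[nu]_x ((x - m) * 1) = s ^+ 2 * \int[nu]_x (0 : R).
  apply: (@normal_prob_stein (cst 1) (cst 0) 1) => x.
  - exact: cvg_cst.
  - by rewrite normr1 mul1r lerDl.
  - by rewrite normr0.
transitivity (\int[nu]_x ((x - m) + m)).
  by apply: eq_Rintegral => x _; rewrite subrK.
rewrite RintegralD//; last exact: finite_measure_integrable_cst.
under eq_Rintegral do rewrite -[_ - m]mulr1.
by rewrite E0 !(@Rintegral_probability_cst _ _ _ nu) mulr0 add0r.
Qed.

Lemma normal_prob_variance : \int[nu]_x (x - m) ^+ 2 = s ^+ 2.
Proof.
have := @normal_prob_stein (fun x => x - m) (cst 1) 1.
rewrite (@Rintegral_probability_cst _ _ _ nu) mulr1 => H.
under eq_Rintegral do rewrite expr2.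
apply: H.
- move=> x; have -> : (fun x => x - m) = (@id R - cst m) by [].
  by apply: is_derive_eq; rewrite subr0.
- by move=> x; exact: cvg_cst.
- by move=> x; rewrite mul1r lerDr.
- by move=> x; rewrite normr1.
Qed.

Lemma normal_prob_cos (u th : R) :
  \int[nu]_x cos (u * (x - m) + th) = expR (- (u ^+ 2 * s ^+ 2) / 2) * cos th.
Proof.
(* Stein's identity gives F' v = - s^2 v F v. *)
pose F v := \int[nu]_x cos (v * (x - m) + th).
have dc (v x : R) : is_derive v (1 : R) (fun v => cos (v * (x - m) + th))
    (- ((x - m) * sin (v * (x - m) + th))).
  have -> : (fun v => cos (v * (x - m) + th)) =
      cos \o ((x - m) *: @id R + cst th).
    by apply/funext => w; rewrite /= !fctE /GRing.scale/= mulrC.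
  apply: is_derive_eq.
  by rewrite /GRing.scale/= !fctE/= /GRing.scale/= mulr1 addr0 mulNr (mulrC v) (mulrC (sin _)).
have mcos v : measurable_fun [set: R] (fun x => cos (v * (x - m) + th)).
  apply: (measurableT_comp (@measurable_cos R)).
  apply: measurable_funD => //; apply: measurable_funM => //.
  exact: measurable_funB.
have icos v : nu.-integrable setT (EFin \o (fun x => cos (v * (x - m) + th))).
  apply: (@integrable_normal_prob_le 1) => // x.
  by rewrite mul1r (le_trans (cos_max _))// lerDl sqr_ge0.
have iB : nu.-integrable setT (EFin \o (fun x => `|x - m|)).
  apply: (@integrable_normal_prob_le 1) => [|x].
    by apply: measurableT_comp => //; exact: measurable_funB.
  rewrite mul1r -[X in 1 + X]real_normK ?num_real// normr_id.
  by have := sqr_ge0 (1 - `|x - m|); have := normr_ge0 (x - m); rewrite !expr2; lra.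
have dF (v : R) : is_derive v (1 : R) F (- (s ^+ 2 * (v * F v))).
  have Iv : `]v - 1, v + 1[%classic v.
    by rewrite /= in_itv/= ltrBlDr ltrDl ltr01.
  have H1 := @derivable_under_integral R _ _ nu
    (fun v x => cos (v * (x - m) + th)) setT measurableT v (v - 1) (v + 1) Iv
    (fun v _ => icos v) (fun w x _ _ => @ex_derive _ _ _ _ _ _ _ (dc w x))
    (fun x => `|x - m|) (fun x => normr_ge0 _) iB.
  have H2 := @differentiation_under_integral R _ _ nu
    (fun v x => cos (v * (x - m) + th)) setT measurableT v (v - 1) (v + 1) Iv
    (fun v _ => icos v) (fun w x _ _ => @ex_derive _ _ _ _ _ _ _ (dc w x))
    (fun x => `|x - m|) (fun x => normr_ge0 _) iB.
  have ub : forall (x : R) (y : R), `]v - 1, v + 1[%classic x ->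
      [set: R] y ->
      `|partial1of2 (fun v x => cos (v * (x - m) + th)) x y| <= `|y - m|.
    move=> w x _ _; rewrite partial1of2E (@derive_val _ _ _ _ _ _ _ (dc w x)).
    by rewrite normrN normrM ler_piMr// sin_max.
  have {}H1 := H1 ub; have {}H2 := H2 ub.
  apply: DeriveDef; first exact: H1.
  rewrite -derive1E H2.
  under eq_Rintegral do rewrite partial1of2E (@derive_val _ _ _ _ _ _ _ (dc _ _)).
  have msin : measurable_fun [set: R] (fun x => sin (v * (x - m) + th)).
    apply: (measurableT_comp (@measurable_sin R)).
    apply: measurable_funD => //; apply: measurable_funM => //.
    exact: measurable_funB.
  have isin : nu.-integrable setT
      (EFin \o (fun x => (x - m) * sin (v * (x - m) + th))).
    apply: (integrable_dominated _ _ iB).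
      by apply: measurable_funM => //; exact: measurable_funB.
    by move=> x; rewrite normrM ler_piMr// sin_max.
  under eq_Rintegral do rewrite -mulN1r.
  rewrite RintegralZl// mulN1r; congr (- _).
  have dsin (x : R) : is_derive x (1 : R) (fun x => sin (v * (x - m) + th))
      (v * cos (v * (x - m) + th)).
    have -> : (fun x => sin (v * (x - m) + th)) =
        sin \o (v *: (@id R - cst m) + cst th) by [].
    apply: is_derive_eq.
    by rewrite /GRing.scale/= !fctE/= /GRing.scale/= subr0 mulr1 addr0 mulrC.
  rewrite (@normal_prob_stein _ _ (1 + `|v|) dsin).
  - by rewrite RintegralZl//; exact: icos.
  - move=> x; apply: cvgM; first exact: cvg_cst.
    apply: (@continuous_comp _ _ _ (fun x => v * (x - m) + th) cos);
      last exact: continuous_cos.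
    apply: cvgD; last exact: cvg_cst.
    apply: cvgM; first exact: cvg_cst.
    by apply: cvgB; [exact: cvg_id|exact: cvg_cst].
  - move=> x; rewrite (le_trans (sin_max _))// mulrDr mulr1 -addrA lerDl.
    by rewrite !(addr_ge0, mulr_ge0).
  - move=> x; rewrite normrM (@le_trans _ _ `|v|)// ?lerDr//.
    by rewrite ler_piMr// cos_max.
(* With its integrating factor, [F] has derivative zero, so its value at [u] is read off at 0, where
   the integrand is the constant [cos th]. *)
have K0 : expR (u ^+ 2 * s ^+ 2 / 2) * F u = expR (0 ^+ 2 * s ^+ 2 / 2) * F 0.
  apply: (@is_derive_0_is_cst _ (fun v => expR (v ^+ 2 * s ^+ 2 / 2) * F v)) => v.
  have dFv := dF v.
  have -> : (fun v => expR (v ^+ 2 * s ^+ 2 / 2) * F v) =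
    (expR \o ((s ^+ 2 / 2) *: (@id R ^+ 2))) * F.
    apply/funext => w.
    change (expR (w ^+ 2 * s ^+ 2 / 2) * F w = expR (s ^+ 2 / 2 * w ^+ 2) * F w).
    by congr (expR _ * _); ring.
  apply: is_derive_eq; rewrite /GRing.scale/= !fctE/= /GRing.scale/=.
  by field.
have -> : expR (- (u ^+ 2 * s ^+ 2) / 2) * cos th =
   expR (- (u ^+ 2 * s ^+ 2) / 2) * (expR (0 ^+ 2 * s ^+ 2 / 2) * F 0).
  rewrite expr0n/= !mul0r expR0 mul1r /F; congr (_ * _).
  under eq_Rintegral do rewrite mul0r add0r.
  by rewrite (@Rintegral_probability_cst _ _ _ nu).
by rewrite -K0 mulrA -expRD mulNr addNr expR0 mul1r.
Qed.

(** Completing the square: the exponential weight moves the mean by [s ^+ 2]. This is the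
    Cameron-Martin formula in dimension one. *)
Lemma expR_normal_pdf (x : R) :
  expR (x - m - s ^+ 2 / 2) * p x = normal_pdf (m + s ^+ 2) s x.
Proof.
rewrite !normal_pdfE ?gt_eqF// /normal_fun mulrCA -expRD; congr (_ * expR _).
by field; rewrite gt_eqF.
Qed.

Lemma integrable_normal_prob_expR :
  nu.-integrable setT (EFin \o (fun x => expR (x - m - s ^+ 2 / 2))).
Proof.
have me : measurable_fun [set: R] (fun x => expR (x - m - s ^+ 2 / 2)).
  apply: (measurableT_comp (@measurable_expR R)).
  by apply: measurable_funB => //; exact: measurable_funB.
apply/(integrable_normal_prob me).2.
rewrite (_ : (fun x => _) = normal_pdf (m + s ^+ 2) s); last first.
  by apply/funext => x; exact: expR_normal_pdf.
exact: integrable_normal_pdf.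
Qed.

End normal_law.

(** The weighted law is the normal law with mean [s ^+ 2]; recentring the argument of the cosine
    there leaves the phase [b * s ^+ 2 + th]. *)
Lemma normal_prob_expR_cos (R : realType) (s b th : R) : 0 < s ->
  \int[normal_prob 0 s]_x (expR (x - s ^+ 2 / 2) * cos (b * x + th)) =
  expR (- (b ^+ 2 * s ^+ 2) / 2) * cos (b * s ^+ 2 + th).
Proof.
move=> s0.
have mc : measurable_fun [set: R] (fun x : R => cos (b * x + th)).
  apply: (measurableT_comp (@measurable_cos R)).
  by apply: measurable_funD => //; exact: measurable_funM.
have me : measurable_fun [set: R] (fun x : R => expR (x - s ^+ 2 / 2)).
  by apply: measurableT_comp => //; exact: measurable_funB.
rewrite Rintegral_normal_prob//; last exact: measurable_funM.
rewrite -(@normal_prob_cos _ (s ^+ 2) s)// Rintegral_normal_prob//.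
  apply: eq_Rintegral => x _; rewrite -[in RHS](add0r (s ^+ 2)).
  rewrite -(expR_normal_pdf 0 s0) subr0 mulrA.
  rewrite [X in X * _ = _]mulrC; congr (_ * _ * _).
  by congr (cos _); ring.
apply: (measurableT_comp (@measurable_cos R)).
apply: measurable_funD => //; apply: measurable_funM => //.
exact: measurable_funB.
Qed.

Lemma Rintegral_dominated_cvg d (T : measurableType d) (R : realType)
    (mu : {measure set T -> \bar R}) (f_ : nat -> T -> R) (f g : T -> R) :
  (forall n, measurable_fun [set: T] (f_ n)) ->
  (forall x, f_ ^~ x @ \oo --> f x) ->
  mu.-integrable setT (EFin \o g) -> (forall n x, `|f_ n x| <= g x) ->
  \int[mu]_x f_ n x @[n --> \oo] --> \int[mu]_x f x.
Proof.
move=> mf ff ig fg.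
have mlim : measurable_fun [set: T] f.
  by apply: (measurable_fun_cvg mf) => x _; exact: ff.
have ffE x : (f_ n x)%:E @[n --> \oo] --> (f x)%:E.
  by apply: cvg_EFin; [exact: nearW|exact: ff].
have [if' _ cvgf] := @dominated_convergence _ _ _ mu _ measurableT
  (fun n => EFin \o f_ n) (EFin \o f) (EFin \o g)
  (fun n => (measurable_EFinP _ _).2 (mf n)) ((measurable_EFinP _ _).2 mlim)
  (aeW _ (fun x _ => ffE x)) ig
  (aeW _ (fun x n _ => fg n x)).
by apply: fine_cvg; rewrite fineK//; exact: integrable_fin_num.
Qed.

(** * Cosine transforms *)

Section law_determined.
Context d (T : measurableType d) (R : realType) (P : probability T R).

Lemma integrable_bounded_mul (V g : T -> R) (M : R) :
  P.-integrable setT (EFin \o V) -> measurable_fun [set: T] g ->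
  (forall x, `|g x| <= M) -> P.-integrable setT (EFin \o (fun x => V x * g x)).
Proof.
move=> iV mg gM; have mV : measurable_fun [set: T] V.
  by apply/measurable_EFinP; exact: (measurable_int P).
apply: (integrable_dominated _ _ (integrable_scale M (integrable_norm iV))).
  exact: measurable_funM.
by move=> x; rewrite normrM mulrC ler_wpM2r.
Qed.

Lemma measurable_cos_affine (X : T -> R) (v th : R) :
  measurable_fun [set: T] X ->
  measurable_fun [set: T] (fun w => cos (v * X w + th)).
Proof.
move=> mX; apply: (measurableT_comp (@measurable_cos R)).
by apply: measurable_funD => //; exact: measurable_funM.
Qed.

Section one_variable.
(* A normal density is the cosine transform of a normal law, so smoothing the
   law of [Y] by it only involves the cosine transform of that law. *)
Let gauss_cos (W Y : T -> R) s z : 0 < s -> P.-integrable setT (EFin \o W) ->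
  measurable_fun [set: T] Y ->
  \int[P]_w (W w * normal_pdf (Y w) s z) =
  normal_peak s * \int[normal_prob 0 s^-1]_x
     \int[P]_w (W w * cos ((- x) * Y w + z * x)).
Proof.
move=> s0 iW mY; pose nu : probability (measurableTypeR R) R := normal_prob 0 s^-1.
have mW : measurable_fun [set: T] W.
  by apply/measurable_EFinP; exact: (measurable_int P).
have mc : measurable_fun [set: T * measurableTypeR R]
    (fun wx => W wx.1 * cos ((- wx.2) * Y wx.1 + z * wx.2)).
  apply: measurable_funM; first exact: measurableT_comp.
  apply: (measurableT_comp (@measurable_cos R)).
  apply: measurable_funD; last exact: measurable_funM.
  apply: measurable_funM; last exact: measurableT_comp.
  exact: measurableT_comp.
have F := @Rintegral_fubini _ _ T (measurableTypeR R) R P nu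
  (fun wx => W wx.1 * cos ((- wx.2) * Y wx.1 + z * wx.2))
  (fun w => `|W w|) (cst 1) mc (integrable_norm iW)
  (finite_measure_integrable_cst _ _ measurableT).
transitivity (normal_peak s *
    \int[P]_w \int[nu]_x (W w * cos (- x * Y w + z * x))); last first.
  congr (_ * _); apply: F => w x.
  by rewrite normrM ler_wpM2l ?cos_max.
pose e w := expR (- (z - Y w) ^+ 2 / (s ^+ 2 *+ 2)).
have me : measurable_fun [set: T] e.
  apply: (measurableT_comp (@measurable_expR R)); apply: measurable_funM => //.
  apply: measurableT_comp => //; apply: measurable_funX.
  exact: measurable_funB.
under eq_Rintegral.
  move=> w _; rewrite normal_pdfE ?gt_eqF// /normal_fun mulrCA; over.
have e_le1 w : `|e w| <= 1.
  rewrite ger0_norm ?expR_ge0// -expR0 ler_expR mulNr oppr_le0.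
  by rewrite divr_ge0 ?sqr_ge0// mulrn_wge0// sqr_ge0.
rewrite RintegralZl//; last exact: (integrable_bounded_mul iW me e_le1).
congr (_ * _); apply: eq_Rintegral => w _ /=; rewrite RintegralZl//; last first.
  apply: (@integrable_dominated _ _ _ nu _ (cst 1)).
  - apply: (measurableT_comp (@measurable_cos R)); apply: measurable_funD.
      by apply: measurable_funM => //; exact: measurableT_comp.
    exact: measurable_funM.
  - by move=> x; exact: cos_max.
  - exact: finite_measure_integrable_cst.
congr (_ * _).
have s'0 : 0 < s^-1 by rewrite invr_gt0.
have := @normal_prob_cos R 0 s^-1 s'0 (z - Y w) 0; rewrite cos0 mulr1 => H.
transitivity (expR (- ((z - Y w) ^+ 2 * s^-1 ^+ 2) / 2)).
  by congr expR; field; rewrite gt_eqF.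
rewrite -H; apply: eq_Rintegral => x _; congr cos; ring.
Qed.

(** The indicator of the interval convolved with a centered normal density of standard deviation
    [s]. *)
Let smooth (s a b x : R) := \int[normal_prob x s]_z \1_(`[a, b]%classic) z.

Let smoothE s a b x : 0 < s ->
  smooth s a b x = \int[@lebesgue_measure R]_z (\1_(`[a, b]%classic) z * normal_pdf x s z).
Proof.
by move=> s0; rewrite /smooth Rintegral_normal_prob//; exact: measurable_indic.
Qed.

Let smooth_ge0 s a b x : 0 <= smooth s a b x.
Proof. by apply: Rintegral_ge0 => z _; rewrite indicE. Qed.

Let integrable_ind_normal s a b x :
  (normal_prob x s).-integrable setT
    (EFin \o (\1_(`[a, b]%classic) : measurableTypeR R -> R)).
Proof. exact: (@integrable_indic _ _ _ (normal_prob x s)). Qed.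

Let smooth_le1 s a b x : smooth s a b x <= 1.
Proof.
rewrite -[leRHS](@Rintegral_probability_cst _ _ _ (normal_prob x s)).
apply: le_Rintegral => //.
- exact: integrable_ind_normal.
- exact: (@finite_measure_integrable_cst _ _ _ (normal_prob x s)).
Qed.

(** With the integrals exchanged, [Y] enters only through the integrals of [W] against normal
    densities at [Y], which [gauss_cos] expresses by cosine transforms. Measurability of the
    smoothed indicator comes from the same double integral. *)
Let smooth_fubini (W Y : T -> R) s a b : 0 < s ->
  P.-integrable setT (EFin \o W) -> measurable_fun [set: T] Y ->
  measurable_fun [set: T] (fun w => smooth s a b (Y w)) /\
  \int[P]_w (W w * smooth s a b (Y w)) =
  \int[@lebesgue_measure R]_z
    (\1_(`[a, b]%classic) z * \int[P]_w (W w * normal_pdf (Y w) s z)).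
Proof.
move=> s0 iW mY.
have mW : measurable_fun [set: T] W.
  by apply/measurable_EFinP; exact: (measurable_int P).
pose I : set (measurableTypeR R) := `[a, b]%classic.
have mI0 : measurable I by exact: measurable_itv.
have pdf_le y z : `|normal_pdf y s z| <= normal_peak s.
  by rewrite ger0_norm ?normal_pdf_ge0// normal_pdf_ub// gt_eqF.
have mpdf : measurable_fun [set: T * measurableTypeR R]
    (fun wz => normal_pdf (Y wz.1) s wz.2).
  rewrite (_ : (fun _ => _) = (fun wz => normal_peak s *
      expR (- (wz.2 - Y wz.1) ^+ 2 / (s ^+ 2 *+ 2)))); last first.
    by apply/funext => wz; rewrite normal_pdfE ?gt_eqF.
  apply: measurable_funM => //.
  apply: (measurableT_comp (@measurable_expR R)); apply: measurable_funM => //.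
  apply: measurableT_comp => //; apply: measurable_funX.
  by apply: measurable_funB => //; exact: measurableT_comp.
have mI : measurable_fun [set: T * measurableTypeR R]
    (fun wz => \1_I wz.2 : R).
  exact: (measurableT_comp (f := \1_I : measurableTypeR R -> R)).
split.
  have : measurable_fun [set: T]
      (fine \o (fun w => \int[lebesgue_measure]_z (\1_I z * normal_pdf (Y w) s z)%:E)%E).
    apply: measurableT_comp => //.
    apply: (@measurable_fun_fubini_tonelli_F _ _ T (measurableTypeR R) R
      lebesgue_measure (fun wz => (\1_I wz.2 * normal_pdf (Y wz.1) s wz.2)%:E)).
      by apply/measurable_EFinP; exact: measurable_funM.
    by move=> wz; rewrite lee_fin mulr_ge0 ?normal_pdf_ge0.
  by apply: eq_measurable_fun => w _; rewrite smoothE.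
have F := @Rintegral_fubini _ _ T (measurableTypeR R) R P lebesgue_measure
  (fun wz => W wz.1 * (\1_I wz.2 * normal_pdf (Y wz.1) s wz.2))
  (fun w => `|W w|) (fun z => normal_peak s * \1_I z).
transitivity (\int[P]_w \int[lebesgue_measure]_z (W w * (\1_I z * normal_pdf (Y w) s z))).
  apply: eq_Rintegral => w _; rewrite smoothE// -RintegralZl//.
  have mi : measurable_fun [set: R] (\1_I : R -> R) by exact: measurable_indic.
  exact/(integrable_normal_prob (Y w) s mi).1/integrable_ind_normal.
transitivity (\int[lebesgue_measure]_z
    \int[P]_w (W w * (\1_I z * normal_pdf (Y w) s z))).
  apply: F.
  - by apply: measurable_funM; [exact: measurableT_comp|exact: measurable_funM].
  - exact: integrable_norm.
  - exact/integrable_scale/integrable_indic_itv.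
  - move=> w z /=; rewrite normrM ler_wpM2l// normrM mulrC.
    by rewrite (@ger0_norm _ (\1_I z)) ?indicE// ler_wpM2r.
apply: eq_Rintegral => z _; rewrite -RintegralZl//.
  by apply: eq_Rintegral => w _ /=; rewrite mulrCA.
apply: (@integrable_bounded_mul _ (fun w => normal_pdf (Y w) s z) _ iW) => //.
exact: (measurableT_comp mpdf (measurable_fun_pair _ _)).
Qed.

Let normal_chebyshev (x s del : R) (A : set (measurableTypeR R)) :
  0 < s -> 0 < del -> measurable A -> (forall z : R, A z -> del <= `|z - x|) ->
  \int[normal_prob x s]_z \1_A z <= (s / del) ^+ 2.
Proof.
move=> s0 d0 mA Ad.
have -> : (s / del) ^+ 2 = \int[normal_prob x s]_z (del ^- 2 * (z - x) ^+ 2).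
  rewrite RintegralZl//; last exact: integrable_normal_prob_sqr.
  by rewrite normal_prob_variance// exprMn exprVn mulrC.
apply: le_Rintegral => //.
- exact: (@integrable_indic _ _ _ (normal_prob x s)).
- exact/integrable_scale/integrable_normal_prob_sqr.
- move=> z _; rewrite indicE; have [/set_mem/Ad dz|_] := boolP (z \in A).
    rewrite /= -ler_pdivrMl ?invr_gt0 ?exprn_gt0// invrK mulr1.
    by rewrite -[leRHS]real_normK ?num_real// lerXn2r// nnegrE// ltW.
  by rewrite mulr_ge0 ?sqr_ge0// invr_ge0 sqr_ge0.
Qed.

(** Without widening, a smoothed indicator of a nondegenerate interval would tend to 1/2 at its
    endpoints. The interval is widened by [k.+1%:R^-1] and the standard deviation is its square, so
    that Chebyshev's error [(s / del) ^+ 2] still tends to 0. *)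
Let smooth_cvg (a b x : R) :
  smooth (k.+1%:R ^- 2) (a - k.+1%:R^-1) (b + k.+1%:R^-1) x @[k --> \oo] -->
  (\1_(`[a, b]%classic) x : R).
Proof.
apply/cvgrPdist_le => /= e e0.
have k0 k : 0 < k.+1%:R :> R by rewrite ltr0n.
have sq k : (k.+1%:R ^- 2 / k.+1%:R^-1) ^+ 2 = k.+1%:R ^- 2 :> R.
  by field; rewrite nat1r pnatr_eq0.
have s0 k : 0 < k.+1%:R ^- 2 :> R by rewrite invr_gt0 exprn_gt0.
pose I k : set (measurableTypeR R) := `[a - k.+1%:R^-1, b + k.+1%:R^-1]%classic.
have mI k : measurable (I k) by exact: measurable_itv.
have inv_small (r : R) : 0 < r -> \forall k \near \oo, k.+1%:R^-1 <= r.
  move=> r0; near=> k; rewrite invf_ple ?posrE//.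
  by apply: le_trans (_ : _ <= k%:R) _; [near: k; exact: nbhs_infty_ger|rewrite ler_nat].
have sqinv k : k.+1%:R ^- 2 <= k.+1%:R^-1 :> R.
  by rewrite lef_pV2 ?posrE ?exprn_gt0// expr2 ler_peMl ?ler1n// ltW.
have smI k : smooth (k.+1%:R ^- 2) (a - k.+1%:R^-1) (b + k.+1%:R^-1) x =
    \int[normal_prob x (k.+1%:R ^- 2)]_z \1_(I k) z by [].
rewrite indicE; have [/set_mem|] := boolP (x \in _); rewrite ?inE/= ?notin_setE/= in_itv/=.
  move=> /andP[ax xb]; near=> k.
  have : \int[normal_prob x (k.+1%:R ^- 2)]_z \1_(~` I k) z <=
      (k.+1%:R ^- 2 / k.+1%:R^-1) ^+ 2.
    apply: normal_chebyshev; rewrite ?invr_gt0//; first exact: measurableC.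
    move=> z; rewrite /I/= in_itv/= => /negP; rewrite negb_and -!ltNge.
    have := ler_norm (z - x); have := ler_norm (- (z - x)).
    rewrite normrN; move: (k.+1%:R^-1) => t h1 h2 /orP[] h3.
    lra.
    lra.
  have -> : \int[normal_prob x (k.+1%:R ^- 2)]_z \1_(~` I k) z =
      1 - smooth (k.+1%:R ^- 2) (a - k.+1%:R^-1) (b + k.+1%:R^-1) x.
    rewrite smI; set N := normal_prob _ _.
    transitivity (\int[N]_z (1 - \1_(I k) z)).
      apply: eq_Rintegral => z _; rewrite !indicE in_setC.
      by case: (_ \in _); rewrite ?subrr ?subr0.
    rewrite RintegralB//.
    - by rewrite (@Rintegral_probability_cst _ _ _ (normal_prob _ _)).
    - exact: (@finite_measure_integrable_cst _ _ _ (normal_prob _ _)).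
    - exact: integrable_ind_normal.
  rewrite sq ger0_norm ?subr_ge0// => /le_trans; apply.
  apply: (le_trans (sqinv k)); near: k; exact: inv_small.
move=> xI.
(* Half the distance from [x] to the violated endpoint: once the widening is at most [del], the
   widened interval stays at distance [del] from [x]. *)
have [del d0 dI] : exists2 del : R, 0 < del & forall k (z : R),
    k.+1%:R^-1 <= del -> I k z -> del <= `|z - x|.
  have [xa|ax] := ltP x a.
    exists ((a - x) / 2); first by rewrite divr_gt0// subr_gt0.
    move=> k z kd; rewrite /I/= in_itv/= => /andP[z1 _].
    by move: kd z1; move: k.+1%:R^-1 => t; have := ler_norm (z - x); lra.
  have [bx|xb] := ltP b x; last by exfalso; apply: xI; rewrite ax.
  exists ((x - b) / 2); first by rewrite divr_gt0// subr_gt0.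
  move=> k z kd; rewrite /I/= in_itv/= => /andP[_ z1].
  by rewrite distrC; move: kd z1; move: k.+1%:R^-1 => t; have := ler_norm (x - z); lra.
near=> k.
rewrite sub0r normrN ger0_norm// smI.
have kd : k.+1%:R^-1 <= del by near: k; exact: inv_small.
apply: (@le_trans _ _ ((k.+1%:R ^- 2 / del) ^+ 2)).
  by apply: normal_chebyshev => // z; exact: dI.
apply: (@le_trans _ _ (k.+1%:R ^- 2)).
  rewrite -[leRHS]sq lerXn2r// ?nnegrE ?divr_ge0 ?invr_ge0 ?sqr_ge0//.
    exact: ltW.
  by rewrite ler_pM2l// lef_pV2// posrE// invr_gt0.
by apply: (le_trans (sqinv k)); near: k; exact: inv_small.
Unshelve. all: by end_near. Qed.

Variables V V' X X' : T -> R.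
Hypotheses (iV : P.-integrable setT (EFin \o V))
  (iV' : P.-integrable setT (EFin \o V')).
Hypotheses (mX : measurable_fun [set: T] X) (mX' : measurable_fun [set: T] X').
Hypothesis cosE : forall v th,
  \int[P]_w (V w * cos (v * X w + th)) = \int[P]_w (V' w * cos (v * X' w + th)).

Let smooth_eq s a b : 0 < s ->
  \int[P]_w (V w * smooth s a b (X w)) = \int[P]_w (V' w * smooth s a b (X' w)).
Proof.
move=> s0; have [_ E] := smooth_fubini a b s0 iV mX.
have [_ E'] := smooth_fubini a b s0 iV' mX'; rewrite [LHS]E [RHS]E'.
have Ez z : \int[P]_w (V w * normal_pdf (X w) s z) =
    \int[P]_w (V' w * normal_pdf (X' w) s z).
  rewrite [LHS](gauss_cos z s0 iV mX) [RHS](gauss_cos z s0 iV' mX').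
  have C x : \int[P]_w (V w * cos (- x * X w + z * x)) =
      \int[P]_w (V' w * cos (- x * X' w + z * x)) by exact: cosE.
  by rewrite (funext C).
by apply: eq_Rintegral => z _; rewrite (Ez z).
Qed.

(** The smoothed indicators have equal integrals by [smooth_eq], and dominated convergence removes
    the smoothing. The weights may be signed, as is required when a cosine of other variables is
    absorbed in them. *)
Lemma cos_determines_itv (a b : R) :
  \int[P]_w (V w * \1_(`[a, b]%classic) (X w)) =
  \int[P]_w (V' w * \1_(`[a, b]%classic) (X' w)).
Proof.
pose s k : R := k.+1%:R ^- 2.
have s0 k : 0 < s k by rewrite invr_gt0 exprn_gt0.
pose S k x := smooth (s k) (a - k.+1%:R^-1) (b + k.+1%:R^-1) x.
have C (W Y : T -> R) : P.-integrable setT (EFin \o W) ->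
    measurable_fun [set: T] Y ->
    \int[P]_w (W w * S k (Y w)) @[k --> \oo] -->
    \int[P]_w (W w * \1_(`[a, b]%classic) (Y w)).
  move=> iW mY.
  have mW : measurable_fun [set: T] W.
    by apply/measurable_EFinP; exact: (measurable_int P).
  apply: (@Rintegral_dominated_cvg _ _ _ P _ _ (fun w => `|W w|)).
  - move=> k; apply: measurable_funM => //.
    by have [] := smooth_fubini (a - k.+1%:R^-1) (b + k.+1%:R^-1) (s0 k) iW mY.
  - by move=> w; apply: cvgM; [exact: cvg_cst|exact: smooth_cvg].
  - exact: integrable_norm.
  - by move=> k w; rewrite normrM (ger0_norm (smooth_ge0 _ _ _ _)) ler_piMr.
have C1 := C _ _ iV mX; have C2 := C _ _ iV' mX'.
have E k : \int[P]_w (V w * S k (X w)) = \int[P]_w (V' w * S k (X' w)).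
  exact: smooth_eq.
move: C1; rewrite (funext E) => C1.
exact: (cvg_unique _ C1 C2).
Qed.

Lemma cos_determines_ray (b : R) :
  \int[P]_w (V w * \1_(`]-oo, b]%classic) (X w)) =
  \int[P]_w (V' w * \1_(`]-oo, b]%classic) (X' w)).
Proof.
have C (W Y : T -> R) : P.-integrable setT (EFin \o W) ->
    measurable_fun [set: T] Y ->
    \int[P]_w (W w * \1_(`[(- k%:R)%R, b]%classic) (Y w)) @[k --> \oo] -->
    \int[P]_w (W w * \1_(`]-oo, b]%classic) (Y w)).
  move=> iW mY.
  have mW : measurable_fun [set: T] W.
    by apply/measurable_EFinP; exact: (measurable_int P).
  apply: (@Rintegral_dominated_cvg _ _ _ P _ _ (fun w => `|W w|)).
  - move=> k; apply: measurable_funM => //.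
    by apply: measurableT_comp => //; exact: measurable_indic.
  - move=> w; apply: cvgM; first exact: cvg_cst.
    apply: cvg_near_cst; near=> k; rewrite !indicE; congr (_ %:R).
    rewrite !mem_setE !in_itv/=; suff -> : - k%:R <= Y w by [].
    rewrite lerNl; near: k; exact: nbhs_infty_ger.
  - exact: integrable_norm.
  - move=> k w; rewrite normrM ler_piMr// indicE.
    by case: (_ \in _); rewrite ?normr1 ?normr0.
have C1 := C _ _ iV mX; have C2 := C _ _ iV' mX'.
move: C1; rewrite (funext (fun k => cos_determines_itv _ _)) => C1.
exact: (cvg_unique _ C1 C2).
Unshelve. all: by end_near. Qed.

End one_variable.
End law_determined.

Section boxes.
Context d (T : measurableType d) (R : realType) (P : probability T R).

(** Segments serve the events that bound [|B t|], rays the events that bound a maximum, and the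
    whole line leaves a coordinate unconstrained. *)
Definition box_side (A : set R) : Prop :=
  [\/ A = setT, exists a b, A = `[a, b]%classic | exists b, A = `]-oo, b]%classic].

Lemma measurable_box_side (A : set R) : box_side A -> measurable A.
Proof. by move=> [->//|[a [b ->]]|[b ->]]; exact: measurable_itv. Qed.

Lemma cosMcos (x y : R) : cos x * cos y = 2^-1 * (cos (x + y) + cos (x - y)).
Proof. by rewrite cosB cosD; field. Qed.

Lemma cos_determines_box (n : nat) (A : nat -> set R) (X X' : nat -> T -> R)
    (V V' : T -> R) :
  (forall i, box_side (A i)) ->
  (forall i, measurable_fun [set: T] (X i)) ->
  (forall i, measurable_fun [set: T] (X' i)) ->
  P.-integrable setT (EFin \o V) -> P.-integrable setT (EFin \o V') ->
  (forall (u : nat -> R) th,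
     \int[P]_w (V w * cos (\sum_(i < n) u i * X i w + th)) =
     \int[P]_w (V' w * cos (\sum_(i < n) u i * X' i w + th))) ->
  \int[P]_w (V w * \prod_(i < n) \1_(A i) (X i w)) =
  \int[P]_w (V' w * \prod_(i < n) \1_(A i) (X' i w)).
Proof.
(* The last indicator is absorbed in the weight: the one-variable result applies
   to the weight times a cosine of the other variables, by product-to-sum. *)
move=> sA mX mX'.
elim: n V V' => [|n IH] V V' iV iV' cosE.
  have := cosE (fun=> 0) 0.
  under eq_Rintegral do rewrite big_ord0 addr0 cos0.
  move=> H; under eq_Rintegral do rewrite big_ord0.
  rewrite H; apply: eq_Rintegral => w _.
  by rewrite !big_ord0 addr0 cos0.
have mS (Y : nat -> T -> R) k (u : nat -> R) : (forall i, measurable_fun [set: T] (Y i)) ->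
    measurable_fun [set: T] (fun w => \sum_(i < k) u i * Y i w).
  by move=> mY; apply: measurable_sum => i; exact: measurable_funM.
have mcos (Y : nat -> T -> R) k (u : nat -> R) th : (forall i, measurable_fun [set: T] (Y i)) ->
    measurable_fun [set: T] (fun w => cos (\sum_(i < k) u i * Y i w + th)).
  move=> mY; apply: (measurableT_comp (@measurable_cos R)).
  by apply: measurable_funD => //; exact: mS.
have mi (Y : T -> R) : measurable_fun [set: T] Y ->
    measurable_fun [set: T] (fun w => \1_(A n) (Y w) : R).
  move=> mY; apply: measurableT_comp => //.
  by apply: measurable_indic; exact: measurable_box_side.
have i1 (x : R) : `|\1_(A n) x : R| <= 1.
  by rewrite indicE; case: (_ \in _); rewrite ?normr1 ?normr0.
have step (Y : nat -> T -> R) (W : T -> R) :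
    \int[P]_w (W w * \prod_(i < n.+1) \1_(A i) (Y i w)) =
    \int[P]_w ((W w * \1_(A n) (Y n w)) * \prod_(i < n) \1_(A i) (Y i w)).
  by apply: eq_Rintegral => w _; rewrite big_ord_recr/= mulrA mulrAC.
rewrite [LHS]step [RHS]step; apply: IH.
- exact: integrable_bounded_mul iV (mi _ (mX n)) (fun w => i1 _).
- exact: integrable_bounded_mul iV' (mi _ (mX' n)) (fun w => i1 _).
move=> u th.
pose C (Y : nat -> T -> R) w := cos (\sum_(i < n) u i * Y i w + th).
have comm (Y : nat -> T -> R) (W : T -> R) :
    \int[P]_w ((W w * \1_(A n) (Y n w)) * C Y w) =
    \int[P]_w ((W w * C Y w) * \1_(A n) (Y n w)).
  by apply: eq_Rintegral => w _; rewrite mulrAC.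
rewrite [LHS]comm [RHS]comm.
have iC (Y : nat -> T -> R) (W : T -> R) : (forall i, measurable_fun [set: T] (Y i)) ->
    P.-integrable setT (EFin \o W) ->
    P.-integrable setT (EFin \o (fun w => W w * C Y w)).
  by move=> mY iW; exact: (integrable_bounded_mul iW (mcos Y n u th mY) (fun w => cos_max _)).
have prod (Y : nat -> T -> R) (W : T -> R) v eta : (forall i, measurable_fun [set: T] (Y i)) ->
    P.-integrable setT (EFin \o W) ->
    \int[P]_w ((W w * C Y w) * cos (v * Y n w + eta)) =
    2^-1 * (\int[P]_w (W w * cos (\sum_(i < n.+1) (if i == n :> nat then v else u i) * Y i w + (th + eta)))
      + \int[P]_w (W w * cos (\sum_(i < n.+1) (if i == n :> nat then - v else u i) * Y i w + (th - eta)))).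
  move=> mY iW.
  have ic c th' := @integrable_bounded_mul _ _ _ P _ _ 1 iW
    (mcos Y n.+1 (fun i => if i == n then c else u i) th' mY)
    (fun w => cos_max _).
  rewrite -RintegralD//; [|exact: ic..].
  rewrite -RintegralZl//; last by apply: integrable_add; exact: ic.
  apply: eq_Rintegral => w _; rewrite -mulrA cosMcos -mulrDr [RHS]mulrCA.
  have sumE (c : R) : \sum_(i < n.+1) (if i == n :> nat then c else u i) * Y i w =
      \sum_(i < n) u i * Y i w + c * Y n w.
    rewrite big_ord_recr/= eqxx; congr (_ + _); apply: eq_bigr => i _.
    by rewrite ltn_eqF.
  by rewrite !sumE; congr (_ * (_ * (cos _ + cos _))); ring.
have cosE' v eta : \int[P]_w ((V w * C X w) * cos (v * X n w + eta)) =
    \int[P]_w ((V' w * C X' w) * cos (v * X' n w + eta)).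
  rewrite [LHS]prod// [RHS]prod//.
  by rewrite (cosE (fun i => if i == n then v else u i))
    (cosE (fun i => if i == n then - v else u i)).
case: (sA n) => [->|[a [b ->]]|[b ->]].
- have := cosE' 0 0.
  have E (Y : nat -> T -> R) (W : T -> R) :
      \int[P]_w ((W w * C Y w) * cos (0 * Y n w + 0)) =
      \int[P]_w ((W w * C Y w) * \1_(setT : set R) (Y n w)).
    by apply: eq_Rintegral => w _; rewrite mul0r addr0 cos0 indicT.
  by rewrite [LHS]E [RHS]E.
- exact: (cos_determines_itv (iC _ _ mX iV) (iC _ _ mX' iV') (mX n) (mX' n) cosE').
- exact: (cos_determines_ray (iC _ _ mX iV) (iC _ _ mX' iV') (mX n) (mX' n) cosE').
Qed.

(** Layer-cake formula: [expR (Y w)] is the length of []0, expR (Y w)[], and Tonelli expresses the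
    weighted expectation by the weighted masses of the events [ln y < Y]. Tonelli is the reason for
    nonnegative weights, and both sides may be infinite. *)
Lemma ge0_integral_expR_ray (V V' X X' : T -> R) :
  (forall w, 0 <= V w) -> (forall w, 0 <= V' w) ->
  measurable_fun [set: T] X -> measurable_fun [set: T] X' ->
  P.-integrable setT (EFin \o V) -> P.-integrable setT (EFin \o V') ->
  \int[P]_w V w = \int[P]_w V' w ->
  (forall b : R, \int[P]_w (V w * \1_(`]-oo, b]%classic) (X w)) =
    \int[P]_w (V' w * \1_(`]-oo, b]%classic) (X' w))) ->
  (\int[P]_w (V w * expR (X w))%:E = \int[P]_w (V' w * expR (X' w))%:E)%E.
Proof.
move=> V0 V'0 mX mX' iV iV' VV' rayE.
have layer (W Y : T -> R) : (forall w, 0 <= W w) -> measurable_fun [set: T] Y ->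
    P.-integrable setT (EFin \o W) ->
    (\int[P]_w (W w * expR (Y w))%:E =
     \int[lebesgue_measure]_(y in `]0%R, +oo[)
       (\int[P]_w W w - \int[P]_w (W w * \1_(`]-oo, ln y]%classic) (Y w)))%:E)%E.
  move=> W0 mY iW.
  have mW : measurable_fun [set: T] W.
    by apply/measurable_EFinP; exact: (measurable_int P).
  pose F (wy : T * measurableTypeR R) : \bar R :=
    (W wy.1 * if (0 < (wy.2 : R)) && ((wy.2 : R) < expR (Y wy.1)) then 1 else 0)%:E.
  have mF : measurable_fun [set: T * measurableTypeR R] F.
    apply/measurable_EFinP/measurable_funM; first exact: measurableT_comp.
    apply: measurable_fun_ifT => //; apply: measurable_and.
      exact: measurable_fun_ltr.
    apply: measurable_fun_ltr => //.
    by apply: measurableT_comp => //; exact: measurableT_comp.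
  have F0 wy : (0 <= F wy)%E by rewrite lee_fin mulr_ge0//; case: ifP.
  transitivity (\int[P]_w \int[lebesgue_measure]_y F (w, y))%E.
    apply: eq_integral => w _.
    transitivity ((W w)%:E *
        \int[lebesgue_measure]_y (\1_(`]0%R, expR (Y w)[%classic) y)%:E)%E.
      rewrite integral_indic//= setIT lebesgue_measure_itv/= lte_fin expR_gt0.
      by rewrite sube0 EFinM.
    rewrite -ge0_integralZl_EFin//; last by apply/measurable_EFinP/measurable_indic.
    apply: eq_integral => y _; rewrite /F/= indicE mem_setE in_itv/=.
    by case: ifP.
  rewrite (@fubini_tonelli _ _ T (measurableTypeR R) R P lebesgue_measure F)//.
  rewrite [RHS]integral_mkcond; apply: eq_integral => y _.
  rewrite patchE mem_setE in_itv/= andbT /F/=.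
  case: ifPn => [y0|_]; last first.
    by under eq_integral do rewrite mulr0; rewrite integral0.
  have iray : P.-integrable setT
      (EFin \o (fun w => W w * \1_(`]-oo, ln y]%classic) (Y w))).
    apply: (integrable_bounded_mul (M := 1) iW).
      by apply: measurableT_comp => //; exact: measurable_indic.
    by move=> w; rewrite indicE; case: (_ \in _); rewrite ?normr1 ?normr0.
  rewrite -RintegralB// /Rintegral fineK; last first.
    apply: integrable_fin_num => //.
    by have := integrableB measurableT iW iray.
  apply: eq_integral => w _; rewrite indicE mem_setE in_itv/=.
  rewrite -{1}(@lnK _ y) ?posrE// ltr_expR ltNge.
  by case: (_ <= _) => /=; rewrite ?mulr1 ?mulr0 ?subrr ?subr0.
rewrite (layer _ _ V0 mX iV) (layer _ _ V'0 mX' iV').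
by apply: eq_integral => y _; rewrite VV' rayE.
Qed.

End boxes.

(** * Gaussian variables *)

Section law.
Context d (T : measurableType d) (R : realType) (P : probability T R).
Variables (X : T -> R) (mX : measurable_fun [set: T] X).
Variable nu : probability (measurableTypeR R) R.
Hypothesis lawX : forall A : set (measurableTypeR R), measurable A ->
  P (X @^-1` A) = nu A.

Let Xm : {mfun T >-> measurableTypeR R} :=
  @mfun_Sub _ _ T (measurableTypeR R) X (mem_set mX).

Lemma ge0_integral_law (f : R -> \bar R) : measurable_fun [set: R] f ->
  (forall x, 0 <= f x)%E -> (\int[P]_w f (X w) = \int[nu]_x f x)%E.
Proof.
move=> mf f0; rewrite -[LHS](@ge0_integral_distribution _ _ _ _ _ P Xm)//.
by apply: eq_measure_integral => A mA _; exact: lawX.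
Qed.

Lemma integrable_law (f : R -> R) : measurable_fun [set: R] f ->
  nu.-integrable setT (EFin \o f) ->
  P.-integrable setT (EFin \o (fun w => f (X w))).
Proof.
move=> mf /integrableP[_ ifin]; apply/integrableP; split.
  by apply/measurable_EFinP; exact: measurableT_comp.
rewrite /= (ge0_integral_law (f := fun x => `|(f x)%:E|)%E)//.
by apply: measurableT_comp => //; exact/measurable_EFinP.
Qed.

Lemma Rintegral_law (f : R -> R) : measurable_fun [set: R] f ->
  nu.-integrable setT (EFin \o f) -> \int[P]_w f (X w) = \int[nu]_x f x.
Proof.
move=> mf inu; rewrite /Rintegral; congr fine.
have mEf : measurable_fun [set: R] (EFin \o f) by exact/measurable_EFinP.
rewrite -[LHS](@integral_distribution _ _ _ _ _ P Xm (EFin \o f))//.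
  by apply: eq_measure_integral => A mA _; exact: lawX.
exact: integrable_law.
Qed.

End law.

Section centered_gaussian.
Context d (T : measurableType d) (R : realType) (P : probability T R).
Variables (X : T -> R) (mX : measurable_fun [set: T] X).
Hypothesis gX : gaussian P X.

(** Integrability stands apart because the mean of a linear combination is computed by linearity,
    before it is known to vanish. The formulas are written with the second moment so that they also
    cover the Dirac case, where a zero mean puts the mass at 0. *)
Lemma gaussian_moments : P.-integrable setT (EFin \o X) /\
  (\int[P]_w X w = 0 ->
   [/\ P.-integrable setT (EFin \o (fun w => X w ^+ 2)),
     P.-integrable setT (EFin \o (fun w => expR (X w))),
     (forall th, \int[P]_w cos (X w + th) =
        expR (- (\int[P]_w X w ^+ 2) / 2) * cos th) &
     (forall b th, \int[P]_w (expR (X w) * cos (b * X w + th)) =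
        expR ((1 - b ^+ 2) * (\int[P]_w X w ^+ 2) / 2)
          * cos (b * (\int[P]_w X w ^+ 2) + th))]).
Proof.
have me : measurable_fun [set: R] (fun x : R => expR x) by exact: measurable_expR.
have m2 : measurable_fun [set: R] (fun x : R => x ^+ 2) by exact: measurable_funX.
have mc th : measurable_fun [set: R] (fun x : R => cos (x + th)).
  by apply: (measurableT_comp (@measurable_cos R)); exact: measurable_funD.
have mec b th : measurable_fun [set: R] (fun x : R => expR x * cos (b * x + th)).
  by apply: measurable_funM => //; exact: measurable_cos_affine.
case: gX => [[m lawX]|[m [s [s0 lawX]]]].
- pose dm : probability (measurableTypeR R) R := @dirac _ (measurableTypeR R) m R.
  have idir (f : R -> R) : measurable_fun [set: R] f ->
      dm.-integrable setT (EFin \o f).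
    move=> mf; have mEf : measurable_fun [set: R] (EFin \o f) by exact/measurable_EFinP.
    apply/integrableP; split=> //; rewrite integral_dirac//.
      by rewrite diracT mul1e ltry.
    exact: measurableT_comp.
  have Rdir (f : R -> R) : measurable_fun [set: R] f ->
      \int[P]_w f (X w) = f m.
    move=> mf; rewrite (Rintegral_law mX (nu := dm) lawX mf (idir f mf)).
    rewrite /Rintegral integral_dirac//; last exact/measurable_EFinP.
    by rewrite diracT mul1e.
  split; first exact: (integrable_law mX (nu := dm) lawX _ (idir id _)).
  rewrite (Rdir id)// => m0; split.
  + exact: (integrable_law mX (nu := dm) lawX m2 (idir _ m2)).
  + exact: (integrable_law mX (nu := dm) lawX me (idir _ me)).
  + move=> th; rewrite (Rdir (fun x => cos (x + th)))// (Rdir (fun x => x ^+ 2))//.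
    by rewrite m0 expr0n/= oppr0 mul0r expR0 mul1r add0r.
  + move=> b th; rewrite (Rdir (fun x => expR x * cos (b * x + th)))//.
    by rewrite (Rdir (fun x => x ^+ 2))// m0 expr0n/= !mulr0 mul0r expR0.
pose nu : probability (measurableTypeR R) R := normal_prob m s.
have iid : nu.-integrable setT (EFin \o (fun x : R => x)).
  apply: (@integrable_normal_prob_le R m s s0 (1 + `|m|)) => // x.
  have -> : (x - m) ^+ 2 = `|x - m| ^+ 2 by rewrite real_normK ?num_real.
  have : `|x| <= `|x - m| + `|m| by rewrite -{1}(subrK m x) ler_normD.
  have := sqr_ge0 (1 - `|x - m|); have := mulr_ge0 (normr_ge0 m) (sqr_ge0 `|x - m|).
  by rewrite !expr2; have := normr_ge0 (x - m); lra.
split; first exact: (integrable_law mX (nu := nu) lawX _ iid).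
rewrite (Rintegral_law mX (nu := nu) lawX _ iid)// normal_prob_mean// => m0.
subst m.
have i2 : nu.-integrable setT (EFin \o (fun x : R => x ^+ 2)).
  have := @integrable_normal_prob_sqr R 0 s s0.
  by under [X in EFin \o X]eq_fun do rewrite subr0.
have ie : nu.-integrable setT (EFin \o (fun x : R => expR x)).
  have := integrable_scale (expR (s ^+ 2 / 2)) (integrable_normal_prob_expR 0 s0).
  under [X in EFin \o X]eq_fun do rewrite -expRD subr0 addrC subrK.
  exact.
have iec b th : nu.-integrable setT (EFin \o (fun x : R => expR x * cos (b * x + th))).
  apply: (@integrable_dominated _ _ _ nu _ _ (mec b th) _ ie) => x.
  by rewrite normrM (ger0_norm (expR_ge0 _)) ler_piMr ?expR_ge0 ?cos_max.
have qE : \int[P]_w X w ^+ 2 = s ^+ 2.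
  rewrite (Rintegral_law mX (nu := nu) lawX m2 i2).
  rewrite -(@normal_prob_variance R 0 s s0).
  by apply: eq_Rintegral => x _; rewrite subr0.
rewrite qE; split.
- exact: (integrable_law mX (nu := nu) lawX m2 i2).
- exact: (integrable_law mX (nu := nu) lawX me ie).
- move=> th; rewrite (Rintegral_law mX (nu := nu) lawX (mc th)).
    have := @normal_prob_cos R 0 s s0 1 th; rewrite expr1n mul1r => <-.
    by apply: eq_Rintegral => x _; rewrite subr0 mul1r.
  apply: (@integrable_dominated _ _ _ nu _ (cst 1)) => //.
  - exact: mc.
  - by move=> x; exact: cos_max.
  - exact: finite_measure_integrable_cst.
- move=> b th; rewrite (Rintegral_law mX (nu := nu) lawX (mec b th))//.
  have -> : \int[nu]_x (expR x * cos (b * x + th)) =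
      \int[nu]_x (expR (s ^+ 2 / 2) * (expR (x - s ^+ 2 / 2) * cos (b * x + th))).
    by apply: eq_Rintegral => x _; rewrite mulrA -expRD (addrC (_ / _)) subrK.
  rewrite RintegralZl//; last first.
    have := integrable_scale (expR (- (s ^+ 2 / 2))) (iec b th).
    under [X in EFin \o X]eq_fun do rewrite mulrA -expRD addrC.
    exact.
  rewrite normal_prob_expR_cos// mulrA -expRD; congr (expR _ * _).
  by field.
Qed.

End centered_gaussian.

Section gaussian_space.
Context d (T : measurableType d) (R : realType) (P : probability T R).
Variable B : R -> {RV P >-> R}.

(** Elements of this space are Gaussian, so joint laws of increments are always reached through laws
    of single variables. Families indexed by [nat] make the concatenation of two sums a mere case
    distinction on the index. *)
Definition gaussian_span (X : T -> R) : Prop :=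
  exists (n : nat) (c t : nat -> R), X = fun w => \sum_(i < n) c i * B (t i) w.

Lemma gaussian_span_base t : gaussian_span (B t).
Proof.
exists 1%N, (fun=> 1), (fun=> t); apply/funext => w.
by rewrite big_ord1 mul1r.
Qed.

Lemma gaussian_span_scale a X :
  gaussian_span X -> gaussian_span (fun w => a * X w).
Proof.
move=> [n [c [t ->]]]; exists n, (fun i => a * c i), t; apply/funext => w.
by rewrite mulr_sumr; apply: eq_bigr => i _; rewrite mulrA.
Qed.

Lemma gaussian_span_add X Y : gaussian_span X -> gaussian_span Y ->
  gaussian_span (fun w => X w + Y w).
Proof.
move=> [n [c [t ->]]] [m [c' [t' ->]]].
exists (n + m)%N, (fun i => if (i < n)%N then c i else c' (i - n)%N),
  (fun i => if (i < n)%N then t i else t' (i - n)%N); apply/funext => w.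
rewrite big_split_ord/=; congr (_ + _); apply: eq_bigr => i _.
  by rewrite ltn_ord.
by rewrite ltnNge leq_addr/= addKn.
Qed.

Lemma gaussian_span_sum n (u : nat -> R) (X : nat -> T -> R) :
  (forall i, gaussian_span (X i)) ->
  gaussian_span (fun w => \sum_(i < n) u i * X i w).
Proof.
move=> sX; elim: n => [|n IH].
  exists 0%N, (fun=> 0), (fun=> 0); apply/funext => w; by rewrite !big_ord0.
have := gaussian_span_add IH (gaussian_span_scale (u n) (sX n)).
by congr gaussian_span; apply/funext => w; rewrite big_ord_recr.
Qed.

Lemma measurable_gaussian_span X : gaussian_span X -> measurable_fun [set: T] X.
Proof.
move=> [n [c [t ->]]]; apply: measurable_sum => i; apply: measurable_funM => //.
Qed.

Hypotheses (gB : gaussian_process B) (cB : centered B).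

Lemma gaussian_gaussian_span X : gaussian_span X -> gaussian P X.
Proof. by move=> [n [c [t ->]]]; exact: (gB (fun i => t i) (fun i => c i)). Qed.

Lemma integrable_gaussian_span X : gaussian_span X ->
  P.-integrable setT (EFin \o X).
Proof.
move=> sX; have [] // := gaussian_moments (measurable_gaussian_span sX)
  (gaussian_gaussian_span sX).
Qed.

Lemma mean_gaussian_span X : gaussian_span X -> \int[P]_w X w = 0.
Proof.
move=> [n [c [t ->]]].
have iB i : P.-integrable setT (EFin \o (fun w => c i * B (t i) w)).
  exact/integrable_gaussian_span/gaussian_span_scale/gaussian_span_base.
elim: n => [|n IH].
  by under eq_Rintegral do rewrite big_ord0; rewrite Rintegral_cst// mul0r.
under eq_Rintegral do rewrite big_ord_recr/=.
have iS : P.-integrable setT (EFin \o (fun w => \sum_(i < n) c i * B (t i) w)).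
  by apply: integrable_gaussian_span; exists n, c, t.
rewrite RintegralD// IH add0r RintegralZl//.
  have := cB (t n); rewrite unlock /Rintegral => ->.
  by rewrite mulr0.
exact/integrable_gaussian_span/gaussian_span_base.
Qed.

Lemma gaussian_span_moments X : gaussian_span X ->
  [/\ P.-integrable setT (EFin \o (fun w => X w ^+ 2)),
     P.-integrable setT (EFin \o (fun w => expR (X w))),
     (forall th, \int[P]_w cos (X w + th) =
        expR (- (\int[P]_w X w ^+ 2) / 2) * cos th) &
     (forall b th, \int[P]_w (expR (X w) * cos (b * X w + th)) =
        expR ((1 - b ^+ 2) * (\int[P]_w X w ^+ 2) / 2)
          * cos (b * (\int[P]_w X w ^+ 2) + th))].
Proof.
move=> sX; have [_] := gaussian_moments (measurable_gaussian_span sX)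
  (gaussian_gaussian_span sX).
by apply; exact: mean_gaussian_span.
Qed.

Lemma integrable_gaussian_spanM X Y : gaussian_span X -> gaussian_span Y ->
  P.-integrable setT (EFin \o (fun w => X w * Y w)).
Proof.
move=> sX sY; have [iX _ _ _] := gaussian_span_moments sX.
have [iY _ _ _] := gaussian_span_moments sY.
apply: (integrable_dominated _ _ (integrable_add iX iY)).
  by apply: measurable_funM; exact: measurable_gaussian_span.
move=> w; rewrite normrM.
have := sqr_ge0 (`|X w| - `|Y w|); have := mulr_ge0 (normr_ge0 (X w)) (normr_ge0 (Y w)).
rewrite -[X w ^+ 2]real_normK ?num_real// -[Y w ^+ 2]real_normK ?num_real//.
rewrite !expr2; lra.
Qed.

Lemma sqr_gaussian_spanD v X Y : gaussian_span X -> gaussian_span Y ->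
  \int[P]_w (X w + v * Y w) ^+ 2 =
  \int[P]_w X w ^+ 2 + 2 * v * \int[P]_w (X w * Y w) + v ^+ 2 * \int[P]_w Y w ^+ 2.
Proof.
move=> sX sY; have [iX _ _ _] := gaussian_span_moments sX.
have [iY _ _ _] := gaussian_span_moments sY.
have iXY := integrable_gaussian_spanM sX sY.
rewrite -!RintegralZl// -RintegralD//; [|exact: integrable_scale..].
rewrite -RintegralD//; [|exact: integrable_add (integrable_scale _ _)
  |exact: integrable_scale].
by apply: eq_Rintegral => w _; ring.
Qed.

Lemma gaussian_span_cos (X : T -> R) th : gaussian_span X ->
  P.-integrable setT (EFin \o (fun w => cos (X w + th))).
Proof.
move=> sX; apply: (@integrable_dominated _ _ _ P _ (cst 1)).
- apply: (measurableT_comp (@measurable_cos R)); apply: measurable_funD => //.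
  exact: measurable_gaussian_span.
- by move=> w; exact: cos_max.
- exact: finite_measure_integrable_cst.
Qed.

Lemma gaussian_span_tilt (xi eta : T -> R) th :
  gaussian_span xi -> gaussian_span eta ->
  \int[P]_w (expR (xi w - (\int[P]_w xi w ^+ 2) / 2) * cos (eta w + th)) =
  expR (- (\int[P]_w eta w ^+ 2) / 2) * cos (\int[P]_w (eta w * xi w) + th).
Proof.
move=> sxi seta.
set q := \int[P]_w xi w ^+ 2; set r := \int[P]_w eta w ^+ 2.
set c := \int[P]_w (eta w * xi w).
have q0 : 0 <= q by apply: Rintegral_ge0 => w _; exact: sqr_ge0.
have [ixi2 ixi _ xiE] := gaussian_span_moments sxi.
(* [b] is the slope of the regression of [eta] on [xi]; when [q = 0] the
   covariance [c] vanishes by Cauchy-Schwarz. *)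
have [b bq] : exists b, b * q = c.
  have [q_eq0|q_neq0] := eqVneq q 0; last by exists (c / q); rewrite divfK.
  exists 0; rewrite mul0r; apply/esym/eqP; apply: contraT => c_neq0.
  have : 0 <= \int[P]_w (eta w + (- (r + 1) / (2 * c)) * xi w) ^+ 2.
    by apply: Rintegral_ge0 => w _; exact: sqr_ge0.
  rewrite sqr_gaussian_spanD// -/q -/r -/c q_eq0 mulr0 addr0.
  have -> : r + 2 * (- (r + 1) / (2 * c)) * c = -1 by field.
  by rewrite ler0N1.
(* The remainder [eta - b * xi] is uncorrelated with [xi] and has second moment [r - b ^+ 2 * q];
   [k] is the expectation of its cosine. Thus [V'] is the conditional expectation of [V] given [xi],
   a fact that [VV'] checks on cosine transforms. *)
pose k := expR (- (r - b ^+ 2 * q) / 2).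
pose V w := cos (eta w + th).
pose V' w := k * cos (b * xi w + th).
have sb a : gaussian_span (fun w => a * xi w) by exact: gaussian_span_scale.
have sqrb a : \int[P]_w (a * xi w) ^+ 2 = a ^+ 2 * q.
  by rewrite -RintegralZl//; apply: eq_Rintegral => w _; rewrite exprMn.
have iV : P.-integrable setT (EFin \o V) by exact: gaussian_span_cos.
have iV' : P.-integrable setT (EFin \o V').
  by apply: integrable_scale; exact: gaussian_span_cos.
have mxi := measurable_gaussian_span sxi.
have mV : measurable_fun [set: T] V by apply/measurable_EFinP; exact: (measurable_int P).
have mV' : measurable_fun [set: T] V' by apply/measurable_EFinP; exact: (measurable_int P).
have VV' v th' : \int[P]_w (V w * cos (v * xi w + th')) =
    \int[P]_w (V' w * cos (v * xi w + th')).
  have sv a : gaussian_span (fun w => eta w + a * xi w).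
    exact: gaussian_span_add.
  transitivity (2^-1 * (\int[P]_w cos ((eta w + v * xi w) + (th + th')) +
      \int[P]_w cos ((eta w + (- v) * xi w) + (th - th')))).
    rewrite -RintegralD//; [|exact: gaussian_span_cos..].
    rewrite -RintegralZl//; last by apply: integrable_add; exact: gaussian_span_cos.
    by apply: eq_Rintegral => w _; rewrite /V cosMcos; congr (_ * (cos _ + cos _)); ring.
  transitivity (k * (2^-1 * (\int[P]_w cos ((b + v) * xi w + (th + th')) +
      \int[P]_w cos ((b - v) * xi w + (th - th'))))); last first.
    rewrite -RintegralD//; [|exact: gaussian_span_cos..].
    rewrite -RintegralZl//; last by apply: integrable_add; exact: gaussian_span_cos.
    rewrite -RintegralZl//; last first.
      by apply: integrable_scale; apply: integrable_add; exact: gaussian_span_cos.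
    apply: eq_Rintegral => w _; rewrite /V' -[RHS]mulrA cosMcos.
    by congr (_ * (_ * (cos _ + cos _))); ring.
  have cE a th'' : \int[P]_w cos (eta w + a * xi w + th'') =
      k * \int[P]_w cos ((b + a) * xi w + th'').
    have [_ _ -> _] := gaussian_span_moments (sv a).
    have [_ _ -> _] := gaussian_span_moments (sb (b + a)).
    rewrite sqr_gaussian_spanD// sqrb -/r -/c -bq mulrA -expRD; congr (expR _ * _).
    by rewrite -/q; field.
  by rewrite !cE; ring.
(* [ge0_integral_expR_ray] wants nonnegative weights, while [V] and [V'] lie between -1 and 1.
   Adding 1 repairs this, and its common contribution is cancelled afterwards by [addrI]. *)
pose W w := 1 + V w; pose W' w := 1 + V' w.
have i1 : P.-integrable setT (EFin \o (fun=> 1 : R)).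
  exact: finite_measure_integrable_cst.
have iW : P.-integrable setT (EFin \o W) by exact: integrable_add.
have iW' : P.-integrable setT (EFin \o W') by exact: integrable_add.
have k01 : 0 <= k <= 1.
  rewrite expR_ge0/= -expR0 ler_expR mulNr oppr_le0 divr_ge0//.
  have : 0 <= \int[P]_w (eta w + (- b) * xi w) ^+ 2.
    by apply: Rintegral_ge0 => w _; exact: sqr_ge0.
  by rewrite sqr_gaussian_spanD// -/q -/r -/c -bq; congr (0 <= _); ring.
have W0 w : 0 <= W w by rewrite /W addrC -lerBlDr sub0r cos_geN1.
have W'0 w : 0 <= W' w.
  rewrite /W' addrC -lerBlDr sub0r; have /andP[k0 k1] := k01.
  have : `|V' w| <= 1 by rewrite normrM ger0_norm// mulr_ile1// cos_max.
  by rewrite ler_norml => /andP[].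
have mc v th' : measurable_fun [set: T] (fun w => cos (v * xi w + th')).
  exact: measurable_cos_affine.
have iVc (U : T -> R) v th' : P.-integrable setT (EFin \o U) ->
    P.-integrable setT (EFin \o (fun w => U w * cos (v * xi w + th'))).
  by move=> iU; exact: (integrable_bounded_mul iU (mc v th') (fun w => cos_max _)).
have WW' v th' : \int[P]_w (W w * cos (v * xi w + th')) =
    \int[P]_w (W' w * cos (v * xi w + th')).
  transitivity (\int[P]_w (1 * cos (v * xi w + th')) +
      \int[P]_w (V w * cos (v * xi w + th'))).
    by rewrite -RintegralD//; [apply: eq_Rintegral => w _; rewrite -mulrDl|exact: iVc..].
  rewrite VV' -RintegralD//; [|exact: iVc..].
  by apply: eq_Rintegral => w _; rewrite -mulrDl.
have WW : \int[P]_w W w = \int[P]_w W' w.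
  have := WW' 0 0; under eq_Rintegral do rewrite mul0r addr0 cos0 mulr1.
  by under [RHS]eq_Rintegral do rewrite mul0r addr0 cos0 mulr1.
have := congr1 fine (ge0_integral_expR_ray W0 W'0 mxi mxi iW iW' WW
  (cos_determines_ray iW iW' mxi mxi WW')).
have iVe (U : T -> R) : measurable_fun [set: T] U -> (forall w, `|U w| <= 1) ->
    P.-integrable setT (EFin \o (fun w => expR (xi w) * U w)).
  by move=> mU U1; exact: (integrable_bounded_mul ixi mU U1).
have iVe1 : P.-integrable setT (EFin \o (fun w => expR (xi w) * V w)).
  by apply: iVe => // w; exact: cos_max.
have iVe2 : P.-integrable setT (EFin \o (fun w => expR (xi w) * V' w)).
  apply: iVe => // w; have /andP[k0 k1] := k01.
  by rewrite normrM ger0_norm// mulr_ile1// cos_max.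
have WE (U : T -> R) : P.-integrable setT (EFin \o (fun w => expR (xi w) * U w)) ->
    fine (\int[P]_w ((1 + U w) * expR (xi w))%:E) =
    \int[P]_w expR (xi w) + \int[P]_w (expR (xi w) * U w).
  move=> iU; rewrite -RintegralD//; congr fine; apply: eq_integral => w _.
  by rewrite mulrDl mul1r (mulrC (U w)).
rewrite [LHS]WE// [RHS]WE// => /addrI VE.
transitivity (expR (- (q / 2)) * \int[P]_w (expR (xi w) * V w)).
  rewrite -RintegralZl//; apply: eq_Rintegral => w _.
  by rewrite mulrA -expRD addrC.
rewrite VE.
transitivity (expR (- (q / 2)) * (k * \int[P]_w (expR (xi w) * cos (b * xi w + th)))).
  congr (_ * _); rewrite -RintegralZl//; last first.
    by apply: iVe => // w; exact: cos_max.
  by apply: eq_Rintegral => w _; rewrite /V' mulrCA.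
rewrite xiE -/q bq /k mulrA mulrA -!expRD; congr (expR _ * _).
by field.
Qed.

End gaussian_space.

(** * Invariance under shifts *)

Section running_max.
Context (R : realType).

(** The recursion starts from [x 0] because the reals have no least element for an empty maximum;
    hence the ranges ['I_n.+1] below. *)
Fixpoint running_max (x : nat -> R) (n : nat) : R :=
  if n is n'.+1 then Num.max (running_max x n') (x n) else x 0%N.

Lemma running_max_le (x : nat -> R) n y :
  (running_max x n <= y) = [forall i : 'I_n.+1, x i <= y].
Proof.
elim: n => [|n IH] /=.
  apply/idP/forallP => [x0 i|/(_ ord0)//]; by rewrite ord1.
rewrite ge_max IH; apply/andP/forallP => [[/forallP xn xn1] i|H]; last first.
  by split; [apply/forallP => i; exact: (H (widen_ord (leqnSn _) i))|exact: (H ord_max)].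
have [i_n|] := ltnP i n.+1; first exact: (xn (Ordinal i_n)).
by move=> n_i; rewrite (_ : i = n.+1 :> nat)//; apply/eqP; rewrite eqn_leq n_i -ltnS ltn_ord.
Qed.

Lemma running_max_add a (x : nat -> R) n :
  a + running_max x n = running_max (fun i => a + x i) n.
Proof. by elim: n => //= n <-; rewrite addr_maxr. Qed.

Lemma measurable_running_max d (T : measurableType d) (X : nat -> T -> R) n :
  (forall i, measurable_fun [set: T] (X i)) ->
  measurable_fun [set: T] (fun w => running_max (fun i => X i w) n).
Proof.
move=> mX; elim: n => [|n IH] /=; first exact: mX.
exact: measurable_maxr.
Qed.

(** Turns the distribution function of a maximum with deterministic corrections [v] into box
    probabilities of the variables themselves. *)
Lemma running_max_ray (x v : nat -> R) n (b : R) :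
  \1_(`]-oo, b]%classic) (running_max (fun i => x i - v i) n) =
  \prod_(i < n.+1) \1_(`]-oo, (b + v i)%R]%classic) (x i) :> R.
Proof.
rewrite indicE mem_setE in_itv/= running_max_le.
have [/forallP H|] := boolP [forall i : 'I_n.+1, x i - v i <= b].
  rewrite big1// => i _; rewrite indicE mem_setE in_itv/= -lerBlDr.
  by rewrite (H i).
rewrite negb_forall => /existsP[i xi]; rewrite (bigD1 i)//= indicE mem_setE in_itv/=.
by rewrite -lerBlDr (negbTE xi) mul0r.
Qed.

End running_max.

Section box_probability.
Context d (T : measurableType d) (R : realType) (P : probability T R).
Variables (n : nat) (Z : nat -> T -> R) (A : nat -> set R).
Hypotheses (mZ : forall i, measurable_fun [set: T] (Z i))
  (mA : forall i, measurable (A i)).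

Lemma measurable_box : measurable [set w | forall i : 'I_n, A i (Z i w)].
Proof.
have -> : [set w | forall i : 'I_n, A i (Z i w)] =
    \bigcap_(i in [set i | (i < n)%N]) (Z i @^-1` A i).
  apply/seteqP; split => [w H i i_n|w H i]; first exact: (H (Ordinal i_n)).
  by apply: H => /=.
by apply: bigcap_measurableType => i _; rewrite -[_ @^-1` _]setTI; exact: mZ.
Qed.

Lemma Rintegral_box : \int[P]_w (\prod_(i < n) \1_(A i) (Z i w)) =
  fine (P [set w | forall i : 'I_n, A i (Z i w)]).
Proof.
set D := [set w | _].
transitivity (\int[P]_w (\1_D w : R)); last first.
  by rewrite /Rintegral integral_indic//= ?setIT//; exact: measurable_box.
apply: eq_Rintegral => w _.
rewrite indicE; have [/set_mem H|] := boolP (w \in D).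
  by rewrite big1// => i _; rewrite indicE mem_set//; exact: H.
rewrite notin_setE => /existsNP[i Ai].
by rewrite (bigD1 i)//= indicE memNset// mul0r.
Qed.

End box_probability.

Section shift.
Context d (T : measurableType d) (R : realType) (P : probability T R).
Variable B : R -> {RV P >-> R}.
Hypotheses (gB : gaussian_process B) (cB : centered B).

Lemma variance_functionE t : variance_function B t = \int[P]_w B t w ^+ 2.
Proof.
rewrite /variance_function /variance unlock (cB t) unlock /Rintegral.
by congr fine; apply: eq_integral => w _; rewrite expr2 -[in RHS](subr0 (B t w)).
Qed.

Lemma gaussian_span_covariance_sum n (u : nat -> R) (X : nat -> T -> R) xi :
  (forall i, gaussian_span B (X i)) -> gaussian_span B xi ->
  \int[P]_w ((\sum_(i < n) u i * X i w) * xi w) =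
  \sum_(i < n) u i * \int[P]_w (X i w * xi w).
Proof.
move=> sX sxi; elim: n => [|n IH].
  under eq_Rintegral do rewrite big_ord0 mul0r.
  by rewrite Rintegral_cst// mul0r big_ord0.
under eq_Rintegral do rewrite big_ord_recr/= mulrDl -mulrA.
rewrite RintegralD//.
- rewrite IH RintegralZl//; first by rewrite big_ord_recr.
  exact: integrable_gaussian_spanM.
- by apply: (integrable_gaussian_spanM gB cB _ sxi); exact: gaussian_span_sum.
- by apply: integrable_scale; exact: (integrable_gaussian_spanM gB cB).
Qed.

Hypothesis sB : stationary_increments B.

Let X h t w := B (t + h) w - B h w.

Let sX h t : gaussian_span B (X h t).
Proof.
have := gaussian_span_add (gaussian_span_base B (t + h))
  (gaussian_span_scale (-1) (gaussian_span_base B h)).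
by congr gaussian_span; apply/funext => w; rewrite mulN1r.
Qed.

Let mX h t : measurable_fun [set: T] (X h t).
Proof. exact: measurable_gaussian_span. Qed.

Let sqrX h t : \int[P]_w X h t w ^+ 2 = \int[P]_w X 0 t w ^+ 2.
Proof.
pose X0 : {mfun T >-> measurableTypeR R} :=
  @mfun_Sub _ _ T (measurableTypeR R) (X 0 t) (mem_set (mX 0 t)).
pose nu : probability (measurableTypeR R) R := distribution P X0.
have m2 : measurable_fun [set: R] (fun x : R => (x ^+ 2)%:E).
  by apply/measurable_EFinP; exact: measurable_funX.
rewrite /Rintegral; congr fine.
rewrite (ge0_integral_law (mX h t) (nu := nu) _ (f := fun x => (x ^+ 2)%:E))//.
- by rewrite (ge0_integral_law (mX 0 t) (nu := nu) _ (f := fun x => (x ^+ 2)%:E))// =>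
    x; rewrite lee_fin sqr_ge0.
- move=> A mA.
  have setE (Y : T -> R) : [set w | forall i : 'I_1, A (Y w)] = Y @^-1` A.
    by apply/seteqP; split => w /= => [/(_ ord0)|Aw _].
  have := @sB h 1 (fun=> t) (fun=> A) (fun=> mA); rewrite !setE => ->.
  rewrite /nu /distribution /pushforward; congr (P _).
  by apply/seteqP; split => w /=; rewrite /X addr0.
- by move=> x; rewrite lee_fin sqr_ge0.
Qed.

Let stationary_box n (tau : nat -> R) h (A : nat -> set R) :
  (forall i, measurable (A i)) ->
  \int[P]_w (\prod_(i < n) \1_(A i) (X h (tau i) w)) =
  \int[P]_w (\prod_(i < n) \1_(A i) (X 0 (tau i) w)).
Proof.
move=> mA.
rewrite [LHS](Rintegral_box P n (fun i => mX h (tau i)) mA).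
rewrite [RHS](Rintegral_box P n (fun i => mX 0 (tau i)) mA).
congr fine; have := sB h (fun i : 'I_n => tau i) (fun i => mA i) => ->.
by congr (P _); apply/seteqP; split => w /= H i; have := H i; rewrite /X addr0.
Qed.

(** The right side is free of [h], so it serves as the common value for any two shifts. *)
Lemma integral_shift_running_max (tau : nat -> R) n h :
  (\int[P]_w (expR (running_max (fun i =>
     B (tau i + h) w - variance_function B (tau i + h) / 2) n))%:E =
   \int[P]_w (expR (running_max (fun i =>
     (B (tau i) w - B 0 w) - (\int[P]_w (B (tau i) w - B 0 w) ^+ 2) / 2) n))%:E)%E.
Proof.
set v := fun i => \int[P]_w (B (tau i) w - B 0 w) ^+ 2.
have vE i h' : \int[P]_w X h' (tau i) w ^+ 2 = v i.
  by rewrite sqrX; apply: eq_Rintegral => w _; rewrite /X addr0.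
pose xi : T -> R := B h.
have sxi : gaussian_span B xi by exact: gaussian_span_base.
pose q := \int[P]_w xi w ^+ 2.
pose c i := \int[P]_w (X h (tau i) w * xi w).
pose V w := expR (xi w - q / 2).
pose Z i w := X h (tau i) w - c i.
have mxi : measurable_fun [set: T] xi by exact: (measurable_gaussian_span sxi).
have mZ i : measurable_fun [set: T] (Z i) by exact: measurable_funB.
have [_ ixi _ _] := gaussian_span_moments gB cB sxi.
have iV : P.-integrable setT (EFin \o V).
  have := integrable_scale (expR (- (q / 2))) ixi.
  by under [X in EFin \o X]eq_fun do rewrite -expRD addrC.
have i1 : P.-integrable setT (EFin \o (fun=> 1 : R)).
  exact: finite_measure_integrable_cst.
have tilt (eta : T -> R) th : gaussian_span B eta ->
    \int[P]_w (V w * cos (eta w + th)) =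
    expR (- (\int[P]_w eta w ^+ 2) / 2) * cos (\int[P]_w (eta w * xi w) + th).
  by move=> seta; exact: gaussian_span_tilt.
(* The phase produced by [tilt] cancels the recentring by [c i]: under the weight [V], the variables
   [Z i] have the unweighted joint law of the increments. *)
have boxE (A : nat -> set R) k : (forall i, box_side (A i)) ->
    \int[P]_w (V w * \prod_(i < k) \1_(A i) (Z i w)) =
    \int[P]_w (1 * \prod_(i < k) \1_(A i) (X h (tau i) w)).
  move=> bA; apply: (cos_determines_box bA mZ (fun i => mX h (tau i)) iV i1) => u th.
  pose eta w := \sum_(i < k) u i * X h (tau i) w.
  have seta : gaussian_span B eta by exact: (gaussian_span_sum _ _ (fun i => sX h (tau i))).
  transitivity (\int[P]_w (V w * cos (eta w + (th - \sum_(i < k) u i * c i)))).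
    apply: eq_Rintegral => w _; congr (_ * cos _).
    under eq_bigr do rewrite mulrBr.
    by rewrite sumrB -addrA (addrC (- _)).
  rewrite tilt//.
  have -> : \int[P]_w (eta w * xi w) = \sum_(i < k) u i * c i.
    exact: (gaussian_span_covariance_sum k u (fun i => sX h (tau i)) sxi).
  rewrite addrCA subrr addr0.
  have [_ _ <- _] := gaussian_span_moments gB cB seta.
  by apply: eq_Rintegral => w _; rewrite mul1r.
(* For [k = 0] the product over the box is empty and [boxE] compares total masses; the ray is a
   dummy side. *)
have VE : \int[P]_w V w = \int[P]_w (1 : R).
  have := boxE (fun=> `]-oo, 0]%classic) 0%N (fun=> Or33 _ _ (ex_intro _ 0 erefl)).
  under eq_Rintegral do rewrite big_ord0 mulr1.
  by under [RHS]eq_Rintegral do rewrite big_ord0 mulr1.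
transitivity (\int[P]_w (V w * expR (running_max (fun i => Z i w - v i / 2) n))%:E)%E.
  apply: eq_integral => w _; congr _%:E; rewrite -expRD running_max_add.
  congr expR; congr running_max; apply/funext => i.
  have -> : variance_function B (tau i + h) = v i + 2 * c i + q.
    rewrite variance_functionE -(vE i h) -[q]mul1r -[X in X * q](expr1n _ 2%N) -[2 * _ in RHS]mulr1.
    rewrite mulrAC -(sqr_gaussian_spanD gB cB 1 (sX h (tau i)) sxi).
    by apply: eq_Rintegral => w' _; rewrite /X mul1r subrK.
  by rewrite /Z /X /xi; field.
transitivity (\int[P]_w (1 * expR (running_max (fun i => X 0 (tau i) w - v i / 2) n))%:E)%E; last first.
  apply: eq_integral => w _; rewrite mul1r; congr (expR _)%:E.
  by congr running_max; apply/funext => i; rewrite /X addr0.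
apply: ge0_integral_expR_ray => //.
- by move=> w; exact: expR_ge0.
- apply: measurable_running_max => i; exact: measurable_funB.
- apply: measurable_running_max => i; exact: measurable_funB.
move=> b.
under eq_Rintegral do rewrite (running_max_ray (Z ^~ _) (fun i => v i / 2)).
under [RHS]eq_Rintegral do rewrite (running_max_ray (fun i => X 0 (tau i) _) (fun i => v i / 2)).
rewrite (boxE (fun i => `]-oo, (b + v i / 2)%R]%classic)); last first.
  by move=> i; apply: Or33; exists (b + v i / 2).
under eq_Rintegral do rewrite mul1r.
under [RHS]eq_Rintegral do rewrite mul1r.
apply: (@stationary_box n.+1 tau h (fun i => `]-oo, (b + v i / 2)%R]%classic)) => i.
exact: measurable_itv.
Qed.

End shift.

(** * Fernique's tail bound *)

Lemma fine_probability_subU d (T : measurableType d) (R : realType)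
    (P : probability T R) (X Y Z : set T) :
  measurable X -> measurable Y -> measurable Z -> X `<=` Y `|` Z ->
  fine (P X) <= fine (P Y) + fine (P Z).
Proof.
move=> mX mY mZ XYZ; rewrite -fineD ?fin_num_measure//.
apply: fine_le; rewrite ?fin_numD ?fin_num_measure//.
apply: (le_trans _ (measureU2 _ _ _)) => //.
by apply: le_measure; rewrite ?inE//; exact: measurableU.
Qed.

Section fernique.
Context d (T : measurableType d) (R : realType) (P : probability T R).
Variable B : R -> {RV P >-> R}.
Hypotheses (gB : gaussian_process B) (cB : centered B).

Let PP : probability (T * T)%type R := (P \x P)%E.

Let cos_PP U U' th : gaussian_span B U -> gaussian_span B U' ->
  \int[PP]_w cos (U w.1 + U' w.2 + th) =
  expR (- (\int[P]_w U w ^+ 2 + \int[P]_w U' w ^+ 2) / 2) * cos th.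
Proof.
move=> sU sU'.
have mU := measurable_gaussian_span sU; have mU' := measurable_gaussian_span sU'.
rewrite (@Rintegral_prod _ _ T T R P P (fun w => cos (U w.1 + U' w.2 + th))
  (cst 1) (cst 1)).
- transitivity (\int[P]_x (expR (- (\int[P]_w U' w ^+ 2) / 2) * cos (U x + th))).
    apply: eq_Rintegral => x _ /=.
    have [_ _ /(_ (U x + th)) <- _] := gaussian_span_moments gB cB sU'.
    by apply: eq_Rintegral => y _; congr cos; ring.
  rewrite RintegralZl//; last exact: (gaussian_span_cos _ sU).
  have [_ _ -> _] := gaussian_span_moments gB cB sU.
  by rewrite mulrA -expRD; congr (expR _ * _); field.
- apply: (measurableT_comp (@measurable_cos R)); apply: measurable_funD => //.
  by apply: measurable_funD; exact: measurableT_comp.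
- exact: finite_measure_integrable_cst.
- exact: finite_measure_integrable_cst.
- by move=> x y; rewrite mulr1 cos_max.
Qed.

Variable tau : nat -> R.
Variable n : nat.

Let r : R := (Num.sqrt 2)^-1.
Let rr : r ^+ 2 = 2^-1. Proof. by rewrite /r exprVn sqr_sqrtr. Qed.

(* The rotation by 45 degrees of two independent copies of the process. *)
Let rot (i : nat) : T * T -> R :=
  if (i < n)%N then fun w => r * (B (tau i) w.1 - B (tau i) w.2)
  else fun w => r * (B (tau (i - n)%N) w.1 + B (tau (i - n)%N) w.2).
Let copies (i : nat) : T * T -> R :=
  if (i < n)%N then fun w => B (tau i) w.1 else fun w => B (tau (i - n)%N) w.2.

Let m1 t : measurable_fun [set: T * T] (fun w => B t w.1).
Proof. exact: measurableT_comp. Qed.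

Let m2 t : measurable_fun [set: T * T] (fun w => B t w.2).
Proof. exact: measurableT_comp. Qed.

Let mrot i : measurable_fun [set: T * T] (rot i).
Proof.
rewrite /rot; case: ifP => _; apply: measurable_funM => //.
  exact: measurable_funB.
exact: measurable_funD.
Qed.

Let mcopies i : measurable_fun [set: T * T] (copies i).
Proof. by rewrite /copies; case: ifP. Qed.

(** A combination of the rotated coordinates is [r * (a + b)] on one copy plus [r * (b - a)] on the
    other. The second moments add up to those of [a] and [b], because the cross terms have opposite
    signs. *)
Let rot_box (A : nat -> set R) : (forall i, box_side (A i)) ->
  \int[PP]_w (\prod_(i < n + n) \1_(A i) (rot i w)) =
  \int[PP]_w (\prod_(i < n + n) \1_(A i) (copies i w)).
Proof.
move=> bA.
have i1 : PP.-integrable setT (EFin \o (fun=> 1 : R)).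
  exact: finite_measure_integrable_cst.
have := cos_determines_box (P := PP) (n := (n + n)%N) bA mrot mcopies i1 i1.
under eq_Rintegral do rewrite mul1r.
under [RHS]eq_Rintegral do rewrite mul1r.
apply => u th.
under eq_Rintegral do rewrite mul1r.
under [RHS]eq_Rintegral do rewrite mul1r.
pose a w := \sum_(i < n) u i * B (tau i) w.
pose b w := \sum_(i < n) u (n + i)%N * B (tau i) w.
have sa : gaussian_span B a by exists n, u, tau.
have sb : gaussian_span B b by exists n, (fun i => u (n + i)%N), tau.
have -> : \int[PP]_w cos (\sum_(i < n + n) u i * copies i w + th) =
    \int[PP]_w cos (a w.1 + b w.2 + th).
  apply: eq_Rintegral => w _; congr (cos (_ + _)); rewrite big_split_ord/=.
  congr (_ + _); apply: eq_bigr => i _; rewrite /copies/= ?ltn_ord//.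
  by rewrite ltnNge leq_addr/= addKn.
have -> : \int[PP]_w cos (\sum_(i < n + n) u i * rot i w + th) =
    \int[PP]_w cos (r * (a w.1 + 1 * b w.1) + r * (b w.2 + (-1) * a w.2) + th).
  apply: eq_Rintegral => w _; congr (cos (_ + _)); rewrite big_split_ord/=.
  have -> : \sum_(i < n) u i * rot i w = r * (a w.1 - a w.2).
    rewrite -sumrB mulr_sumr; apply: eq_bigr => i _.
    by rewrite /rot ltn_ord; ring.
  have -> : \sum_(i < n) u (n + i)%N * rot (n + i)%N w = r * (b w.1 + b w.2).
    rewrite -big_split mulr_sumr; apply: eq_bigr => i _.
    by rewrite /rot ltnNge leq_addr/= addKn; ring.
  by ring.
rewrite cos_PP//.
rewrite (@cos_PP (fun w => r * (a w + 1 * b w)) (fun w => r * (b w + (-1) * a w))); last 2 first.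
- by apply: gaussian_span_scale; apply: gaussian_span_add => //; exact: gaussian_span_scale.
- by apply: gaussian_span_scale; apply: gaussian_span_add => //; exact: gaussian_span_scale.
have sqr_r (U : T -> R) : gaussian_span B U ->
    \int[P]_w (r * U w) ^+ 2 = 2^-1 * \int[P]_w U w ^+ 2.
  move=> sU; have [iU _ _ _] := gaussian_span_moments gB cB sU.
  rewrite -RintegralZl//; apply: eq_Rintegral => w _.
  by rewrite exprMn rr.
rewrite !sqr_r; [|by apply: gaussian_span_add => //; exact: gaussian_span_scale..].
rewrite (sqr_gaussian_spanD gB cB 1 sa sb) (sqr_gaussian_spanD gB cB (-1) sb sa).
have -> : \int[P]_w (b w * a w) = \int[P]_w (a w * b w).
  by apply: eq_Rintegral => w _; rewrite mulrC.
by congr (expR _ * _); field.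
Qed.

Definition small_ball (s : R) : set T :=
  [set w | forall i : 'I_n, `|B (tau i) w| <= s].

Let sym_itv (s : R) (x : R) : (`[(- s)%R, s]%classic x) = (`|x| <= s).
Proof. by rewrite /= in_itv/= ler_norml. Qed.

Lemma measurable_small_ball s : measurable (small_ball s).
Proof.
have := @measurable_box _ T R n (fun i => B (tau i)) (fun=> `[(- s)%R, s]%classic)
  (fun i => measurable_funPT _) (fun i => measurable_itv _).
congr measurable; apply/seteqP; split => w /= H i; have := H i; by rewrite -?sym_itv.
Qed.

Let PP_X (X Y : set T) : measurable X -> measurable Y ->
  PP (X `*` Y) = (P X * P Y)%E.
Proof. exact: product_measure1E. Qed.

Let copies_box (A : nat -> set R) : (forall i, measurable (A i)) ->
  \int[PP]_w (\prod_(i < n + n) \1_(A i) (copies i w)) =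
  fine (P [set w | forall i : 'I_n, A i (B (tau i) w)]) *
  fine (P [set w | forall i : 'I_n, A (n + i)%N (B (tau i) w)]).
Proof.
move=> mA; rewrite (Rintegral_box PP (n + n) mcopies mA).
have -> : [set w | forall i : 'I_(n + n), A i (copies i w)] =
    [set w | forall i : 'I_n, A i (B (tau i) w)] `*`
    [set w | forall i : 'I_n, A (n + i)%N (B (tau i) w)].
  apply/seteqP; split => [w H|w [H1 H2] i] /=.
    split => i /=.
      by have := H (lshift n i); rewrite /copies/= ltn_ord.
    by have := H (rshift n i); rewrite /copies/= ltnNge leq_addr/= addKn.
  rewrite /copies; case: ltnP => i_n; first exact: (H1 (Ordinal i_n)).
  have i_n' : (i - n < n)%N by rewrite ltn_subLR.
  by have := H2 (Ordinal i_n'); rewrite /= subnKC.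
have mB' (A' : nat -> set R) : (forall i, measurable (A' i)) ->
    measurable [set w | forall i : 'I_n, A' i (B (tau i) w)].
  move=> mA'.
  exact: (@measurable_box _ T R n (fun i => B (tau i)) A' (fun i => measurable_funPT _) mA').
have mAn := mB' _ (fun i => mA (n + i)%N).
by rewrite (PP_X (mB' _ mA) mAn) fineM ?fin_num_measure//; exact: mB'.
Qed.

Let F s := fine (P (small_ball s)).

(** With [M] the maximum of [|B (tau i)|], this is [P(M <= s) P(M > t) <= P(M > v)^2] written
    through [F]. The event that the rotated differences stay within [s] is split according to
    whether the rotated sums stay within [t]. *)
Lemma fernique_inequality (s t v : R) : v <= (Num.sqrt 2)^-1 * (t - s) ->
  F s <= F s * F t + (1 - F v) ^+ 2.
Proof.
move=> vst.
pose I (s : R) : set R := `[(- s)%R, s]%classic.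
pose A1 i := if (i < n)%N then I s else setT.
pose A2 i := if (i < n)%N then I s else I t.
have bI s' : box_side (I s') by apply: Or32; exists (- s'), s'.
have bA1 i : box_side (A1 i) by rewrite /A1; case: ifP => // _; apply: Or31.
have bA2 i : box_side (A2 i) by rewrite /A2; case: ifP.
have mA1 i := measurable_box_side (bA1 i).
have mA2 i := measurable_box_side (bA2 i).
have Fball s' : fine (P [set w | forall i : 'I_n, I s' (B (tau i) w)]) = F s'.
  congr (fine (P _)); apply/seteqP; split => w /= H i; have := H i; by rewrite -?sym_itv.
have P1 : fine (PP [set w | forall i : 'I_(n + n), A1 i (rot i w)]) = F s.
  rewrite -(Rintegral_box PP (n + n) mrot mA1) rot_box// copies_box//.
  rewrite (_ : [set w | forall i : 'I_n, A1 (n + i)%N _] = setT); last first.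
    by apply/seteqP; split => // w _ i; rewrite /A1 ltnNge leq_addr.
  rewrite probability_setT mulr1 -Fball; congr (fine (P _)).
  by apply/seteqP; split => w /= H i; have := H i; rewrite /A1 ltn_ord.
have P2 : fine (PP [set w | forall i : 'I_(n + n), A2 i (rot i w)]) = F s * F t.
  rewrite -(Rintegral_box PP (n + n) mrot mA2) rot_box// copies_box// -!Fball.
  congr (fine (P _) * fine (P _)).
    by apply/seteqP; split => w /= H i; have := H i; rewrite /A2 ltn_ord.
  by apply/seteqP; split => w /= H i; have := H i; rewrite /A2 ltnNge leq_addr.
have mC := measurableC (measurable_small_ball v).
have P3 : fine (PP (~` small_ball v `*` ~` small_ball v)) = (1 - F v) ^+ 2.
  rewrite PP_X// fineM ?fin_num_measure//.
  by rewrite probability_setC ?fineB ?fin_num_measure//; exact: measurable_small_ball.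
have mG1 := measurable_box (n + n) mrot mA1.
have mG2 := measurable_box (n + n) mrot mA2.
rewrite -{1}P1 -P2 -P3.
apply: fine_probability_subU => //; first by apply: measurableX.
move=> w G1; have [G2|nG2] := pselect ([set w | forall i : 'I_(n + n), A2 i (rot i w)] w).
  by left.
right.
(* At some time one rotated coordinate is at most [s] and the other exceeds
   [t]; rotating back, both copies exceed [(t - s) / sqrt 2]. *)
have [i [Yi Zi]] : exists i : 'I_n, `|r * (B (tau i) w.1 - B (tau i) w.2)| <= s /\
    t < `|r * (B (tau i) w.1 + B (tau i) w.2)|.
  have H1 (i : 'I_n) : `|r * (B (tau i) w.1 - B (tau i) w.2)| <= s.
    by have := G1 (lshift n i); rewrite /A1 /rot/= ltn_ord /I/= in_itv/= ler_norml.
  have [i nGi] : exists i : 'I_(n + n), ~ A2 i (rot i w) by apply/existsNP.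
  have := ltn_ord i; move: (nat_of_ord i) nGi => {}i nGi i_nn.
  move: nGi; rewrite /A2 /rot; case: ltnP => i_n.
    case; rewrite /I/= in_itv/= -ler_norml; exact: (H1 (Ordinal i_n)).
  have i_n' : (i - n < n)%N by rewrite ltn_subLR.
  move=> nGi; exists (Ordinal i_n'); split; first exact: H1.
  rewrite ltNge; apply/negP => ?; apply: nGi.
  by rewrite /I/= in_itv/= -ler_norml.
set x := B (tau i) w.1 in Yi Zi *; set y := B (tau i) w.2 in Yi Zi *.
have xE : x = r * (r * (x - y) + r * (x + y)).
  have := rr; rewrite expr2 => rr'; rewrite (_ : r * _ = (r * r) * (2 * x)); last by ring.
  by rewrite rr' mulrA mulVf// mul1r.
have yE : y = r * (r * (x + y) - r * (x - y)).
  have := rr; rewrite expr2 => rr'; rewrite (_ : r * _ = (r * r) * (2 * y)); last by ring.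
  by rewrite rr' mulrA mulVf// mul1r.
have r0 : 0 < r by rewrite invr_gt0 sqrtr_gt0.
have far p q : `|p| <= s -> t < `|q| -> v < `|r * (q + p)|.
  move=> ps tq; rewrite normrM (gtr0_norm r0); apply: (le_lt_trans vst).
  rewrite ltr_pM2l//; have := lerB_dist q (- p); rewrite opprK normrN.
  by apply: lt_le_trans; apply: ltr_leB.
split; move=> /(_ i); apply/negP; rewrite -ltNge/=.
  by rewrite -/x xE addrC; apply: far.
by rewrite -/y yE; apply: far; rewrite ?normrN.
Qed.

End fernique.

Lemma nneseries_le (R : realType) (u : (\bar R)^nat) (M : \bar R) :
  (forall n, 0 <= u n)%E -> (forall n, \sum_(0 <= i < n) u i <= M)%E ->
  (\sum_(0 <= i <oo) u i <= M)%E.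
Proof.
move=> u0 uM; apply: lime_le; first by apply: is_cvg_nneseries => n _ _; exact: u0.
by apply: nearW => n; exact: uM.
Qed.

Lemma nneseries_ge_term (R : realType) (u : (\bar R)^nat) k :
  (forall n, 0 <= u n)%E -> (u k <= \sum_(0 <= i <oo) u i)%E.
Proof.
move=> u0; apply: le_trans (nneseries_lim_ge k.+1 (fun n _ _ => u0 n)).
by rewrite big_nat_recr//= leeDr// sume_ge0.
Qed.

Lemma sum_geometric_le (R : realFieldType) (c : R) n : 0 <= c < 1 ->
  \sum_(0 <= i < n) c ^+ i <= (1 - c)^-1.
Proof.
move=> /andP[c0 c1]; rewrite -[leRHS]mul1r ler_pdivlMr ?subr_gt0// mulrC.
by rewrite big_mkord -opprB mulNr -subrX1 opprB gerBl exprn_ge0.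
Qed.

Section fernique_radius.
Variable R : realType.
Implicit Types s : R.

Let q : R := Num.sqrt 2.

Let qq : q * q = 2. Proof. by rewrite -expr2 sqr_sqrtr. Qed.

Let q_ge : 5 / 4 <= q.
Proof.
have q0 : 0 <= q by rewrite sqrtr_ge0.
by have := qq; nra.
Qed.

(* Solves [T k = (T k.+1 - s) / sqrt 2], so that fernique_inequality squares the
   tail probability at each step. *)
Fixpoint fernique_radius s (k : nat) : R :=
  if k is k'.+1 then Num.sqrt 2 * fernique_radius s k' + s else s.

(** A crude bound, sufficient for each outcome to lie in some ball when [s] is positive. *)
Lemma fernique_radius_ge s k : 0 <= s -> s * k.+1%:R <= fernique_radius s k.
Proof.
move=> s0; elim: k => [|k IH]; first by rewrite mulr1.
have T0 : 0 <= fernique_radius s k by apply: le_trans IH; rewrite mulr_ge0.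
rewrite /= -/q -[k.+2%:R]natr1 mulrDr mulr1 lerD2r (le_trans IH)//.
by rewrite ler_peMl//; apply: le_trans q_ge; lra.
Qed.

(** The form [5 * q ^+ k - 4] is exact at [k = 0], and its induction step amounts to [5 <= 4 * q],
    which is [q_ge]. *)
Lemma fernique_radius_le s k : 0 <= s -> fernique_radius s k <= s * (5 * q ^+ k - 4).
Proof.
move=> s0; elim: k => [|k IH]; first by rewrite /= expr0; lra.
rewrite /= -/q exprS; have := ler_wpM2l (_ : 0 <= q) IH => /(_ (sqrtr_ge0 _)) IH'.
have : s * (5 / 4) <= s * q by rewrite ler_wpM2l.
move: IH'; rewrite (_ : q * (s * (5 * q ^+ k - 4)) = s * (5 * (q * q ^+ k) - 4 * q)); last by ring.
by move: (q ^+ k) => x; nra.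
Qed.

(* Bounds the exponential moment of a maximum whose tail at fernique_radius s k
   is at most expR (-2) ^+ (2 ^ k). *)
Definition fernique_bound s : \bar R :=
  ((expR s)%:E + \sum_(0 <= k <oo)
     (expR (fernique_radius s k.+1) * expR (-2) ^+ (2 ^ k))%:E)%E.

(** With [x = q ^+ k], the radius is at most [c * x] and the tail exponent is [- 2 * x ^+ 2], as
    [2 ^ k = x ^+ 2]. One of the two squares absorbs the radius, [c * x <= x ^+ 2 + c ^+ 2 / 4]; the
    other leaves a series dominated by a geometric one. *)
Lemma fernique_bound_lty s : 0 <= s -> (fernique_bound s < +oo)%E.
Proof.
move=> s0; rewrite /fernique_bound.
pose c := 5 * s * q; pose e : R := expR (-1).
have e01 : 0 <= e < 1 by rewrite expR_ge0/= expR_lt1 ltrN10.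
suff : (\sum_(0 <= k <oo) (expR (fernique_radius s k.+1) * expR (-2) ^+ (2 ^ k))%:E
    <= (expR (c ^+ 2 / 4) * (1 - e)^-1)%:E)%E.
  by move=> /le_lt_trans/(_ (ltry _)) H; rewrite lte_add_pinfty// ltry.
apply: nneseries_le => [k|n].
  by rewrite lee_fin mulr_ge0 ?exprn_ge0 ?expR_ge0.
rewrite sumEFin lee_fin.
apply: (@le_trans _ _ (expR (c ^+ 2 / 4) * \sum_(0 <= k < n) e ^+ k)); last first.
  by rewrite ler_pM2l ?expR_gt0// sum_geometric_le.
rewrite mulr_sumr; apply: ler_sum => k _.
apply: (@le_trans _ _ (expR (c ^+ 2 / 4) * e ^+ (2 ^ k))); last first.
  rewrite ler_pM2l ?expR_gt0// ler_wiXn2l//.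
  - by case/andP: e01.
  - by case/andP: e01 => _ /ltW.
  - exact/ltnW/ltn_expl.
rewrite -!expRM_natl -!expRD ler_expR.
have -> : (2 ^ k)%:R = (q ^+ k) ^+ 2 :> R.
  by rewrite natrX -qq -expr2 -!exprM mulnC.
apply: (@le_trans _ _ (c * q ^+ k + (q ^+ k) ^+ 2 * - 2)); last first.
  by move: (q ^+ k) => x; have := sqr_ge0 (x - c / 2); rewrite !expr2; lra.
rewrite lerD2r; apply: le_trans (fernique_radius_le _ s0) _.
by rewrite exprS /c; move: (q ^+ k) => x; nra.
Qed.

End fernique_radius.

Section fernique_moment.
Context d (T : measurableType d) (R : realType) (P : probability T R).
Variable B : R -> {RV P >-> R}.
Hypotheses (gB : gaussian_process B) (cB : centered B).
Variables (tau : nat -> R) (n : nat) (s : R).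
Hypothesis s0 : 0 < s.
Hypothesis Fs : 1 - fine (P (small_ball B tau n s)) <= expR (-2) / 2.

Let F t := fine (P (small_ball B tau n t)).

(** Divided by [F s], the tail is squared at each step. The factor 1/2 in [Fs] starts the induction:
    it forces [F s >= 1 / 2], whence [1 - F s <= F s * expR (-2)]. *)
Let tail k : 1 - F (fernique_radius s k) <= F s * expR (-2) ^+ (2 ^ k).
Proof.
have e2 : expR (-2) < 1 :> R by rewrite expR_lt1; lra.
have e0 : 0 < expR (-2) :> R by exact: expR_gt0.
have Fs2 : 1 / 2 <= F s by move: Fs; rewrite -/(F s) => ?; lra.
elim: k => [|k IH] /=.
  by rewrite expn0 expr1; move: Fs; rewrite -/(F s) => ?; nra.
have := @fernique_inequality _ T R P B gB cB tau n s (fernique_radius s k.+1) (fernique_radius s k).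
rewrite /= addrK mulrA mulVf ?gt_eqF ?sqrtr_gt0// mul1r lexx => /(_ isT).
rewrite -/(F _) -/(F _) -/(F _) => H.
have : (1 - F (fernique_radius s k)) ^+ 2 <= (F s * expR (-2) ^+ (2 ^ k)) ^+ 2.
  rewrite lerXn2r// nnegrE ?mulr_ge0 ?exprn_ge0//; try lra.
  rewrite subr_ge0 -lee_fin fineK ?fin_num_measure//; last exact: measurable_small_ball.
  exact/probability_le1/measurable_small_ball.
rewrite exprMn -exprM -expnSr => H2.
have Fs0 : 0 < F s by lra.
rewrite -(ler_pM2l Fs0); apply: le_trans (_ : _ <= F s ^+ 2 * expR (-2) ^+ (2 ^ k.+1)) _; last by rewrite mulrA.
by apply: le_trans _ H2; rewrite mulrBr mulr1 lerBlDr addrC.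
Qed.

(** Take the least [k] whose ball contains the outcome. For [k = 0] the constant [expR s] dominates;
    otherwise the outcome is outside the previous ball and the corresponding term of the series
    dominates. *)
Lemma fernique_moment (g : T -> R) : (forall w, exists i : 'I_n, g w <= `|B (tau i) w|) ->
  (\int[P]_w (expR (g w))%:E <= fernique_bound s)%E.
Proof.
move=> gB'.
have mC k := measurableC (@measurable_small_ball _ T R P B tau n (fernique_radius s k)).
pose h k w : \bar R := (expR (fernique_radius s k.+1) *
  \1_(~` small_ball B tau n (fernique_radius s k)) w)%:E.
have h0 k w : (0 <= h k w)%E.
  by rewrite lee_fin mulr_ge0 ?expR_ge0.
have mh k : measurable_fun setT (h k).
  apply/measurable_EFinP; apply: measurable_funM => //.
apply: (@le_trans _ _ (\int[P]_w ((expR s)%:E + \sum_(0 <= k <oo) h k w))%E).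
  apply: ae_ge0_le_lower_integral => //.
  - by move=> w; rewrite adde_ge0 ?nneseries_ge0// lee_fin expR_ge0.
  - by apply: emeasurable_funD => //; exact: ge0_emeasurable_sum.
  apply: nearW => w.
  have exk : exists k, w \in small_ball B tau n (fernique_radius s k).
    pose M := \sum_(i < n) `|B (tau i) w|.
    have M0 : 0 <= M by apply: sumr_ge0 => i _.
    exists (Num.bound (M / s)); rewrite inE => i.
    apply: le_trans (fernique_radius_ge _ (ltW s0)).
    apply: (@le_trans _ _ M); first by rewrite /M (bigD1 i)//= lerDl sumr_ge0.
    rewrite mulrC -ler_pdivrMr//; apply: ltW.
    apply: lt_le_trans (archi_boundP (divr_ge0 M0 (ltW s0))) _.
    by rewrite ler_nat.
  have [i gi] := gB' w.
  have [[|k'] wk' kmin] := ex_minnP exk.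
    move: wk'; rewrite inE => /(_ i) wk'.
    by rewrite lee_paddr ?nneseries_ge0// lee_fin ler_expR (le_trans gi).
  have nwk' : ~ small_ball B tau n (fernique_radius s k') w.
    by move=> /mem_set/kmin; rewrite ltnn.
  rewrite lee_paddl ?lee_fin ?expR_ge0//; apply: le_trans (nneseries_ge_term k' _) => //.
  rewrite lee_fin indicE mem_set//= mulr1 ler_expR (le_trans gi)//.
  by move: wk'; rewrite inE => /(_ i).
rewrite ge0_integralD//; last 2 first.
- by move=> w _; rewrite nneseries_ge0.
- exact: ge0_emeasurable_sum.
have -> : (\int[P]__ (expR s)%:E = (expR s)%:E)%E.
  by rewrite integral_cst// [X in (_ * X)%E](probability_setT P) mule1.
rewrite integral_nneseries// /fernique_bound.
rewrite leeD2l//; apply: lee_nneseries => [k _|k _]; first by rewrite integral_ge0.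
rewrite /h; under eq_integral do rewrite EFinM.
rewrite ge0_integralZl_EFin ?expR_ge0//; last first.
  by apply/measurable_EFinP; exact: (measurable_indic (mC k)).
rewrite integral_indic// setIT EFinM lee_wpmul2l ?lee_fin ?expR_ge0//.
have PC : P (~` small_ball B tau n (fernique_radius s k)) =
    (1 - F (fernique_radius s k))%:E.
  by rewrite probability_setC ?EFinB ?fineK ?fin_num_measure//; exact: measurable_small_ball.
rewrite [X in (X <= _)%E]PC lee_fin.
apply: le_trans (tail k) _; rewrite ler_piMl ?exprn_ge0 ?expR_ge0//.
rewrite -lee_fin fineK ?fin_num_measure//; last exact: measurable_small_ball.
exact/probability_le1/measurable_small_ball.
Qed.

End fernique_moment.

(** * Suprema over intervals *)

Lemma countable_range T (A : set T) : countable A -> A !=set0 ->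
  exists u : nat -> T, range u = A.
Proof.
move=> /countable_injP[g injg] [a Aa].
pose u n := if pselect (exists2 x, A x & g x = n) is left e then projT1 (cid2 e) else a.
exists u; apply/seteqP; split => [_ [n _ <-]|x Ax].
  by rewrite /u; case: pselect => // e; case: cid2.
exists (g x) => //; rewrite /u; case: pselect => [e|[]]; last by exists x.
by case: cid2 => y Ay /= gy; apply: injg; rewrite ?inE.
Qed.

(** * Convergence of the series of suprema of [expR (- f)] *)

Section pseries.
Variables (R : realType) (a : R).
Hypothesis a1 : 1 < a.

(** Integral comparison in discrete form: with [p k] the power [- (a - 1)] of [k.+1], each term
    after the first is at most [(p k - p k.+1) / (a - 1)], and these differences telescope. *)
Lemma sum_expR_ln_le n :
  \sum_(0 <= k < n) expR (- (a * ln k.+1%:R)) <= 1 + (a - 1)^-1.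
Proof.
have b0 : 0 < a - 1 by rewrite subr_gt0.
pose p k := expR (- ((a - 1) * ln k.+1%:R)).
have step k : expR (- (a * ln k.+2%:R)) <= (p k - p k.+1) / (a - 1).
  rewrite ler_pdivlMr//.
  pose x : R := k.+2%:R; have x0 : 0 < x by [].
  (* From [ln (1 + y) <= y] at [y = - x^-1], since [k.+1 = x * (1 - x^-1)]. *)
  have lnB : ln k.+1%:R <= ln x - x^-1.
    have -> : k.+1%:R = x * (1 + - x^-1).
      by rewrite mulrDr mulr1 mulrN divff ?gt_eqF// /x -[k.+2%:R]natr1 addrK.
    have xV : 0 < 1 + - x^-1 by rewrite subr_gt0 invf_lt1// ltr1n.
    by rewrite lnM ?posrE// lerD2l le_ln1Dx// ltrN2 invf_lt1// ltr1n.
  have -> : expR (- (a * ln x)) = p k.+1 * x^-1.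
    have -> : x^-1 = expR (- ln x) by rewrite expRN lnK.
    by rewrite /p -/x -expRD; congr expR; ring.
  have -> : p k = p k.+1 * expR ((a - 1) * (ln x - ln k.+1%:R)).
    by rewrite /p -/x -expRD; congr expR; ring.
  rewrite -[X in _ <= _ - X]mulr1 -mulrBr -mulrA ler_pM2l ?expR_gt0//.
  rewrite lerBrDl; apply: le_trans (expR_ge1Dx _).
  by rewrite lerD2l mulrC ler_pM2l// lerBrDl -lerBrDr.
case: n => [|n]; first by rewrite big_geq// addr_ge0// invr_ge0 ltW.
apply: (@le_trans _ _ (1 + (1 - p n) / (a - 1))); last first.
  by rewrite lerD2l ler_pdivrMr// mulVf ?gt_eqF// gerBl expR_ge0.
elim: n => [|n IH]; first by rewrite big_nat1 /p/= ln1 !mulr0 oppr0 expR0 subrr mul0r addr0.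
rewrite big_nat_recr//=; apply: le_trans (lerD IH (step n)) _.
by rewrite -addrA lerD2l -mulrDl addrA subrK.
Qed.

End pseries.

(** Compactness in near-covering form, the bound [M] being the parameter that tends to infinity:
    local bounds merge into a uniform one. *)
Lemma locally_bounded_itv (R : realType) (f : R -> R) (b : R) : locally_bounded f ->
  exists M : R, forall t : R, 0 <= t <= b -> `|f t| <= M.
Proof.
move=> lf; have /compact_near_coveringP cov := @segment_compact R 0 b.
have {}cov := cov R (+oo%R : set_system R) (fun (M t : R) => 0 <= t -> `|f t| <= M) _.
have /cov : forall t : R, `[0, b]%classic t ->
    \forall t' \near t & M \near +oo%R, 0 <= t' -> `|f t'| <= M.
  move=> t /=; rewrite in_itv/= => /andP[t0 tb].
  have [M fM] : exists M : R, within `[0, +oo[%classic (nbhs t) [set x | `|f x| <= M].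
    by apply: (filter_ex (F := (+oo%R : set_system R))); exact: lf.
  exists ([set x : R | `[0, +oo[%classic x -> `|f x| <= M], [set N : R | M <= N]) => /=.
    split; first exact: fM.
    by exists M; split; [exact: num_real|move=> x /ltW].
  move=> [x N] /= [fxM MN] x0; apply: le_trans MN; apply: fxM.
  by rewrite in_itv/= x0.
move=> covb; have [M fM] := filter_ex (F := (+oo%R : set_system R)) covb.
exists M => t t0b; apply: fM => /=; first by rewrite in_itv.
by case/andP: t0b.
Qed.

Section series_bound.
Variables (R : realType) (f : R -> R) (a : R).
Hypotheses (lf : locally_bounded f) (a1 : 1 < a).
Hypothesis fa : forall t, 0 < t -> a * ln t < f t.

Lemma sup_expR_series_lty :
  (\sum_(0 <= i <oo) ereal_sup [set (expR (- f (t * 1)))%:E | t in `[i%:R, i.+1%:R]] < +oo)%E.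
Proof.
have [M fM] := locally_bounded_itv 1 lf.
apply: (@le_lt_trans _ _ (expR M + (1 + (a - 1)^-1))%:E); last exact: ltry.
have sup_ge0 i : (0 <= ereal_sup [set (expR (- f (t * 1)))%:E | t in `[i%:R, i.+1%:R]])%E.
  apply: ereal_sup_ge; exists (expR (- f (i%:R * 1)))%:E; last by rewrite lee_fin expR_ge0.
  by exists i%:R => //=; rewrite in_itv/= lexx ler_nat leqnSn.
apply: nneseries_le => // n.
(* On [[0, 1]] the logarithm gives no useful lower bound for [f], so local boundedness takes over.
   On [[i, i + 1]] with [i > 0], [f] is above [a * ln i]. *)
pose v i := if i is k.+1 then expR (- (a * ln k.+1%:R)) else expR M.
apply: (@le_trans _ _ (\sum_(0 <= i < n) (v i)%:E)%E).
  apply: lee_sum => i _; apply: ge_ereal_sup => _ [t /=] + <-.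
  rewrite in_itv/= mulr1 lee_fin /v; case: i => [|i] t01; rewrite ler_expR.
    by rewrite lerNl; have := fM t t01; rewrite ler_norml => /andP[].
  have /andP[it _] := t01; have t0 : 0 < t by apply: lt_le_trans it.
  rewrite lerN2; apply: le_trans (ltW (fa t0)); rewrite ler_pM2l ?(lt_trans _ a1)//.
  by rewrite ler_ln ?posrE.
rewrite sumEFin lee_fin; case: n => [|n].
  by rewrite big_geq// addr_ge0 ?expR_ge0// addr_ge0// invr_ge0 subr_ge0 ltW.
by rewrite big_nat_recl// lerD2l; exact: sum_expR_ln_le.
Qed.

End series_bound.

Lemma running_max_attained (R : realType) (x : nat -> R) n :
  exists i : 'I_n.+1, running_max x n = x i.
Proof.
elim: n => [|n [i IH]] /=; first by exists ord0.
rewrite /Num.max; case: ifP => _; first by exists ord_max.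
by exists (widen_ord (leqnSn _) i).
Qed.

(** * Suprema sampled along a sequence of times *)

Section sampled_supremum.
Context d (T : measurableType d) (R : realType) (P : probability T R).
Variable B : R -> {RV P >-> R}.

Let Y t w := B t w - variance_function B t / 2.

(** A supremum written as a monotone limit of finite maxima: measurability and monotone convergence
    are then immediate, and shift invariance passes to the limit from each [n]. *)
Definition sampled_sup (tau : nat -> R) (h : R) (w : T) : \bar R :=
  limn (fun n => (expR (running_max (fun i =>
    B (tau i + h) w - variance_function B (tau i + h) / 2) n))%:E).

Let nd tau h w : {homo (fun n => (expR (running_max (fun i => Y (tau i + h) w) n))%:E) :
  n m / (n <= m)%N >-> (n <= m)%E}.
Proof.
apply/nondecreasing_seqP => n; rewrite lee_fin ler_expR /=.
by rewrite le_max lexx.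
Qed.

Let sampled_supE tau h w : sampled_sup tau h w =
  ereal_sup (range (fun n => (expR (running_max (fun i => Y (tau i + h) w) n))%:E)).
Proof. exact/cvg_lim/ereal_nondecreasing_cvgn/nd. Qed.

Lemma sampled_sup_ge tau h w i :
  ((expR (B (tau i + h) w - variance_function B (tau i + h) / 2))%:E <= sampled_sup tau h w)%E.
Proof.
rewrite sampled_supE; apply: le_trans (ereal_sup_ubound _); last by exists i.
rewrite lee_fin ler_expR.
have := running_max_le (fun i => Y (tau i + h) w) i (running_max (fun i => Y (tau i + h) w) i).
by rewrite lexx => /esym/forallP/(_ ord_max).
Qed.

Lemma sampled_sup_le tau h w (M : \bar R) :
  (forall i, (expR (B (tau i + h) w - variance_function B (tau i + h) / 2))%:E <= M)%E ->
  (sampled_sup tau h w <= M)%E.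
Proof.
move=> HM; apply: lime_le; first exact: (ereal_nondecreasing_is_cvgn (nd tau h w)).
apply: nearW => n.
have [i] := running_max_attained (fun i => Y (tau i + h) w) n.
by rewrite /Y => ->.
Qed.

Lemma sampled_sup_ge0 tau h w : (0 <= sampled_sup tau h w)%E.
Proof. by apply: le_trans (sampled_sup_ge tau h w 0); rewrite lee_fin expR_ge0. Qed.

Let mexp tau h n : measurable_fun [set: T]
  (fun w => (expR (running_max (fun i => Y (tau i + h) w) n))%:E).
Proof.
apply/measurable_EFinP; apply: measurableT_comp => //.
by apply: measurable_running_max => i; apply: measurable_funB.
Qed.

Lemma measurable_sampled_sup tau h : measurable_fun [set: T] (sampled_sup tau h).
Proof.
apply: (@emeasurable_fun_cvg _ _ _ _
  (fun n w => (expR (running_max (fun i => Y (tau i + h) w) n))%:E)) => [n|w _].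
  exact: mexp.
exact: (ereal_nondecreasing_is_cvgn (nd tau h w)).
Qed.

Lemma integral_sampled_sup tau h :
  (\int[P]_w sampled_sup tau h w =
   limn (fun n => \int[P]_w (expR (running_max (fun i =>
     B (tau i + h) w - variance_function B (tau i + h) / 2)%R n))%:E))%E.
Proof.
apply: (monotone_convergence P measurableT (mexp tau h)) => [n w _|w _].
  by rewrite lee_fin expR_ge0.
exact: nd.
Qed.

Hypotheses (gB : gaussian_process B) (cB : centered B).

Lemma integral_sampled_sup_shift tau h : stationary_increments B ->
  (\int[P]_w sampled_sup tau h w = \int[P]_w sampled_sup tau 0 w)%E.
Proof.
move=> sB; rewrite !integral_sampled_sup; congr (limn _); apply/funext => n.
by rewrite !(integral_shift_running_max gB cB sB).
Qed.

(** Bounded paths make the events [E k] increase to an almost sure event, and continuity from below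
    selects a radius. Intersecting over all [n] inside [E k] is what makes this radius independent
    of [n]. *)
Lemma small_ball_eventually_large (tau : nat -> R) (b e : R) : bounded_paths B ->
  (forall i, 0 <= tau i <= b) -> 0 < e ->
  exists2 s : R, 0 < s & forall n, 1 - fine (P (small_ball B tau n s)) <= e.
Proof.
move=> bB tau0b e0.
pose E k : set T := \bigcap_n small_ball B tau n k.+1%:R.
have mE k : measurable (E k).
  by apply: bigcap_measurableType => n _; exact: measurable_small_ball.
have mU : measurable (\bigcup_k E k) by exact: bigcup_measurable.
have PU : P (\bigcup_k E k) = 1%E.
  suff PC : P (~` \bigcup_k E k) = 0%E.
    by have := probability_setC P (measurableC mU); rewrite setCK PC sube0.
  apply: measure_negligible; first exact: measurableC.
  apply: negligibleS bB => w /= nUw bw; apply: nUw.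
  have [M bM] := filter_ex (F := (+oo%R : set_system R)) (bw 0 b).
  exists (Num.bound M) => // n _ i.
  have {}bM : `|B (tau i) w| <= M by apply: (bM (tau i)); rewrite /= in_itv/=; exact: tau0b.
  apply: le_trans bM _.
  have [M0|/ltW M0] := leP 0 M; last by apply: le_trans M0 _.
  by apply: ltW; apply: lt_le_trans (archi_boundP M0) _; rewrite ler_nat.
have ndE : {homo E : n m / (n <= m)%N >-> (n <= m)%O}.
  move=> k l kl; apply/subsetPset => w Ew n _ i.
  by apply: le_trans (Ew n I i) _; rewrite ler_nat.
have cE : P (E k) @[k --> \oo] --> P (\bigcup_k E k) := nondecreasing_cvg_mu mE mU ndE.
have [k Pk] : exists k, ((1 - e)%:E < P (E k))%E.
  apply: contrapT => /forallNP H.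
  have : (limn (fun k => P (E k)) <= (1 - e)%:E)%E.
    apply: lime_le; first by apply/cvg_ex; eexists; exact: cE.
    by apply: nearW => k; rewrite leNgt; apply/negP; exact: H.
  by rewrite (cvg_lim _ cE)// PU lee_fin lerBrDl gerDr leNgt e0.
exists k.+1%:R => // n.
rewrite lerBlDr -lerBlDl -lee_fin fineK ?fin_num_measure//; last exact: measurable_small_ball.
apply: le_trans (ltW Pk) _; apply: le_measure; rewrite ?inE//; first exact: measurable_small_ball.
by move=> w Ew; exact: Ew.
Qed.

(** Dropping the nonnegative variance term bounds the exponent by [|B (tau i)|]. The Fernique bound
    does not depend on [n], hence survives the limit. *)
Lemma integral_sampled_sup_lty (tau : nat -> R) (b : R) : bounded_paths B ->
  (forall i, 0 <= tau i <= b) -> (\int[P]_w sampled_sup tau 0 w < +oo)%E.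
Proof.
move=> bB tau0b.
have [s s0 Fs] := small_ball_eventually_large bB tau0b
  (divr_gt0 (expR_gt0 (-2)) (@ltr0Sn R 1)).
apply: le_lt_trans (fernique_bound_lty (ltW s0)).
rewrite integral_sampled_sup; apply: lime_le.
  apply: ereal_nondecreasing_is_cvgn => n m nm.
  apply: ge0_le_integral => //; try by move=> w _; rewrite lee_fin expR_ge0.
  - exact: mexp.
  - exact: mexp.
  - by move=> w _; exact: (nd tau 0 w).
apply: nearW => n; apply: (fernique_moment gB cB s0 (Fs n.+1)) => w.
have [i] := running_max_attained (fun i => Y (tau i + 0) w) n.
rewrite /Y => ->; exists i; rewrite addr0; apply: le_trans (ler_norm _).
rewrite gerBl divr_ge0// variance_functionE//.
by apply: Rintegral_ge0 => w' _; exact: sqr_ge0.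
Qed.

End sampled_supremum.

Section separability.
Context d (T : measurableType d) (R : realType) (P : probability T R).
Variable B : R -> {RV P >-> R}.

Let Y t w := B t w - variance_function B t / 2.

(** [Y t] is a continuous function of the pair formed by [B t] and its variance, so exceeding [y] is
    an open condition on the pair, and the closure property supplies a time of [D]. Restricting [t]
    to the interior leaves room for a ball inside the interval. *)
Lemma separable_drift : separable_with_variance B ->
  exists2 D : set R, countable D &
    {ae P, forall w, forall t a b y : R, a < t < b -> y < Y t w ->
       exists2 s, D s & a < s < b /\ y < Y s w}.
Proof.
move=> [D cD sD]; exists D => //; apply: filterS sD => w /= sDw t a b y /andP[a_t t_b] yY.
pose e := Num.min (t - a) (b - t).
have e0 : 0 < e by rewrite lt_min !subr_gt0 a_t.
pose phi (p : R * R) : R := p.1 - p.2 / 2.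
have cphi : continuous phi.
  move=> p; apply: cvgB; first exact: cvg_fst.
  by apply: cvgM; [exact: cvg_snd|exact: cvg_cst].
have oU : open [set x : R | y < x] by exact: open_gt.
have nU : nbhs (B t w, variance_function B t) (phi @^-1` [set x : R | y < x]).
  by apply: cphi; apply: open_nbhs_nbhs; split.
have [_ [[s [Ds ts] <-] ys]] := sDw t e e0 _ nU.
exists s => //; split; last exact: ys.
move: ts; rewrite /ball/= lt_min !ltr_distlC => /andP[/andP[? ?] /andP[? ?]].
by apply/andP; split; lra.
Qed.

Lemma dominating_times (delta : R) : 0 < delta -> separable_with_variance B ->
  exists2 tau : nat -> R, (forall n, 0 <= tau n <= delta) &
    {ae P, forall w, forall i t, i%:R * delta <= t <= i.+1%:R * delta ->
       ((expR (B t w - variance_function B t / 2))%:E <=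
        sampled_sup B tau (i%:R * delta) w)%E}.
Proof.
move=> d0 /separable_drift[D cD sD].
(* The separating set is translated back from every interval, so that a single
   sequence of times serves all of them. *)
pose S := [set 0; delta] `|`
  \bigcup_(i in [set: nat]) ((fun x => x - i%:R * delta) @` D `&` `[0, delta]%classic).
have cS : countable S.
  rewrite /S -bigcup2E; apply: bigcup_countable => // -[|[|_]] _ //=.
    exact: finite_set_countable.
  apply: bigcup_countable => // i _.
  apply: sub_countable (sub_countable (card_image_le (fun x => x - i%:R * delta) _) cD).
  by apply: subset_card_le => x [].
have [tau tauS] : exists tau : nat -> R, range tau = S.
  by apply: countable_range => //; exists 0; left; left.
exists tau.
  move=> n; have : S (tau n) by rewrite -tauS; exists n.
  case=> [[->|->]|[i _ [_ /=]]]; rewrite ?lexx ?(ltW d0)//.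
apply: filterS sD => w /= sDw i t it.
(* If the sampled supremum fell below the value at [t], it would be a finite [x > 0], and [Y] would
   exceed the level [ln x] at [t] but at no shifted time of [S]. *)
rewrite leNgt; apply/negP => sup_lt.
have tauP s : S s -> ((expR (Y (s + i%:R * delta) w))%:E <= sampled_sup B tau (i%:R * delta) w)%E.
  rewrite -tauS => -[n _ <-]; exact: sampled_sup_ge.
have [x xE] : exists x, sampled_sup B tau (i%:R * delta) w = x%:E.
  case: sampled_sup (sampled_sup_ge0 B tau (i%:R * delta) w) sup_lt => [x| |]//.
  by exists x.
have x0 : 0 < x.
  have : S 0 by left; left.
  by move=> /tauP; rewrite xE lee_fin; apply: lt_le_trans; rewrite expR_gt0.
have {sup_lt}yY : ln x < Y t w.
  by move: sup_lt; rewrite xE lte_fin -{1}(lnK (x0 : x \is Num.pos)) ltr_expR.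
have notS s : S (s - i%:R * delta) -> ~ ln x < Y s w.
  move=> /tauP; rewrite subrK xE lee_fin -{1}(lnK (x0 : x \is Num.pos)) ler_expR.
  by rewrite leNgt => /negP.
have itB : i.+1%:R * delta = i%:R * delta + delta by rewrite -natr1 mulrDl mul1r.
(* The two endpoints, out of reach of [separable_drift], correspond to the times 0 and [delta] put
   into [S] by hand. *)
have [t0|t0] := eqVneq t (i%:R * delta).
  by apply: (notS t) => //; left; left; rewrite t0 /= subrr.
have [t1|t1] := eqVneq t (i.+1%:R * delta).
  by apply: (notS t) => //; left; right; rewrite t1 itB /= addrAC subrr add0r.
have it' : i%:R * delta < t < i.+1%:R * delta.
  by rewrite !lt_neqAle eq_sym t0 t1.
have [s Ds [/andP[s1 s2] ys]] := sDw _ _ _ _ it' yY.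
apply: (notS s) => //; right; exists i => //; split; first by exists s.
by rewrite /= in_itv/= subr_ge0 ltW//= lerBlDl -itB ltW.
Qed.

End separability.

(** * The bound for the Piterbarg constant *)

Section piterbarg_bound.
Context d (T : measurableType d) (R : realType) (P : probability T R).
Variables (B : R -> {RV P >-> R}) (f : R -> R).
Hypotheses (gB : gaussian_process B) (cB : centered B).
Hypotheses (vB : separable_with_variance B) (sB : stationary_increments B).
Hypothesis bB : bounded_paths B.

Lemma wills_ge0 (delta : R) : 0 < delta -> (0 <= wills B delta)%E.
Proof.
move=> d0; apply: integral_ge0 => w _; apply: ereal_sup_ge.
exists (expR (B 0 w - variance_function B 0 / 2))%:E; last by rewrite lee_fin expR_ge0.
by exists 0 => //=; rewrite in_itv/= lexx ltW.
Qed.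

Lemma wills_lty (delta : R) : 0 < delta -> (wills B delta < +oo)%E.
Proof.
move=> d0; have [tau tau0 dom] := dominating_times d0 vB.
apply: le_lt_trans (integral_sampled_sup_lty gB cB bB tau0).
apply: ae_ge0_le_lower_integral.
- move=> w; apply: ereal_sup_ge; exists (expR (B 0 w - variance_function B 0 / 2))%:E.
    by exists 0 => //=; rewrite in_itv/= lexx ltW.
  by rewrite lee_fin expR_ge0.
- by move=> w; exact: sampled_sup_ge0.
- exact: measurable_sampled_sup.
apply: filterS dom => w /= domw; apply: ge_ereal_sup => _ [t /= + <-].
rewrite in_itv/= => t0d; have := domw 0%N t.
by rewrite mul0r mul1r; apply.
Qed.

Lemma piterbarg_le (delta : R) : 0 < delta ->
  (piterbarg B f <= piterbarg_bound B f delta)%E.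
Proof.
move=> d0; have [tau tau0 dom] := dominating_times d0 vB.
pose s i := ereal_sup [set (expR (- f (t * delta)))%:E | t in `[i%:R, i.+1%:R]].
have s0 i : (0 <= s i)%E.
  apply: ereal_sup_ge; exists (expR (- f (i%:R * delta)))%:E; last by rewrite lee_fin expR_ge0.
  by exists i%:R => //=; rewrite in_itv/= lexx ler_nat leqnSn.
pose G i w := sampled_sup B tau (i%:R * delta) w.
have G0 i w : (0 <= G i w)%E by exact: sampled_sup_ge0.
have mG i : measurable_fun [set: T] (G i) by exact: measurable_sampled_sup.
pose q := (\int[P]_w sampled_sup B tau 0 w)%E.
have q0 : (0 <= q)%E by apply: integral_ge0 => w _; exact: sampled_sup_ge0.
have qoo : (q < +oo)%E by exact: (integral_sampled_sup_lty gB cB bB tau0).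
(* The times [tau i] lie in [[0, delta]]. The Wills functional is brought in only through this
   comparison; the series below is integrated with the measurable [G i]. *)
have q_wills : (q <= wills B delta)%E.
  apply: ge0_le_lower_integral; first by move=> w; exact: sampled_sup_ge0.
  move=> w; apply: sampled_sup_le => i; apply: ereal_sup_ubound.
  by exists (tau i); rewrite ?addr0//= in_itv/=; exact: tau0.
apply: (@le_trans _ _ (\int[P]_w (\sum_(0 <= i <oo) s i * G i w))%E).
  apply: ae_ge0_le_lower_integral.
  - move=> w; apply: ereal_sup_ge; exists (expR (B 0 w - variance_function B 0 / 2 - f 0))%:E.
      by exists 0 => //=; rewrite in_itv/= lexx.
    by rewrite lee_fin expR_ge0.
  - by move=> w; apply: nneseries_ge0 => i _ _; rewrite mule_ge0.
  - apply: ge0_emeasurable_sum => [i w _ _|i _]; first by rewrite mule_ge0.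
    exact: measurable_funeM.
  apply: filterS dom => w /= domw; apply: ge_ereal_sup => _ [t /= + <-].
  rewrite in_itv/= andbT => t0.
  (* The index of the interval of length [delta] containing [t]; a single term of the series already
     dominates the integrand at [t]. *)
  pose i := Num.truncn (t / delta).
  have /andP[i1 i2] := truncn_itv (divr_ge0 t0 (ltW d0)).
  apply: le_trans (nneseries_ge_term i _); last by move=> n; rewrite mule_ge0.
  rewrite expRD EFinM muleC lee_pmul ?lee_fin ?expR_ge0//.
    apply: ereal_sup_ubound; exists (t / delta).
      by rewrite /= in_itv/= i1 ltW.
    by rewrite divfK ?gt_eqF.
  by apply: domw; rewrite -ler_pdivlMr// i1 -ler_pdivrMr// ltW.
rewrite integral_nneseries//; last 2 first.
- by move=> i; exact: measurable_funeM.
- by move=> i w _; rewrite mule_ge0.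
have termE i : (\int[P]_w (s i * G i w) = q * s i)%E.
  by rewrite ge0_integralZl// [X in (_ * X)%E](integral_sampled_sup_shift gB cB tau _ sB) muleC.
have qfin : q \is a fin_num by rewrite ge0_fin_numE.
under eq_eseriesr do rewrite termE -(fineK qfin).
rewrite nneseriesZl// fineK// /piterbarg_bound lee_wpmul2r// nneseries_ge0//.
Qed.

End piterbarg_bound.

Unset Implicit Arguments.

Theorem theorem3p2 (d : measure_display) (T : measurableType d) (R : realType)
    (P : probability T R) (B : R -> {RV P >-> R}) (f : R -> R) (a : R) :
  gaussian_process B ->
  centered B ->
  separable_with_variance B ->
  stationary_increments B ->
  bounded_paths B ->
  measurable_fun (`[0, +oo[ : set R) f ->
  locally_bounded f ->
  1 < a ->
  (forall t, 0 < t -> a * ln t < f t) ->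
  [/\ (piterbarg B f < +oo)%E,
      (piterbarg B f <=
         ereal_inf [set piterbarg_bound B f delta | delta in `]0%R, +oo[])%E
    & (ereal_inf [set piterbarg_bound B f delta | delta in `]0%R, +oo[] < +oo)%E].
Proof.
move=> gB cB vB sB bB _ lf a1 fa.
(* The single value [delta = 1] settles both finiteness claims: it bounds the Piterbarg constant as
   well as the infimum. *)
have bound_lty : (piterbarg_bound B f 1 < +oo)%E.
  rewrite /piterbarg_bound lte_mul_pinfty ?wills_ge0//.
  - by rewrite ge0_fin_numE ?wills_ge0// wills_lty.
  - exact: (sup_expR_series_lty lf a1 fa).
split.
- exact: le_lt_trans (piterbarg_le f gB cB vB sB bB ltr01) bound_lty.
- apply: le_ereal_inf_tmp => _ [delta /= + <-]; rewrite in_itv/= andbT => d0.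
  exact: piterbarg_le.
- apply: le_lt_trans bound_lty; apply: ereal_inf_lbound.
  by exists 1 => //=; rewrite in_itv/= ltr01.
Qed.
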